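(* Consider problem (P): $\min_{x\in H} f(x)+g(x)+\sum_{i=1}^m h_i(B_ix)$ under the standing assumptions below. Let $\gamma\in(0,2/L)$ and let $\sigma,\tau>0$ satisfy $\sigma\tau<1/\sum_{i=1}^m\|B_i\|^2$. Given arbitrary $x^0\in H$ and $y_i^0\in G_i$ ($i=1,\dots,m$), define for $k\ge0$ $$x^{k+1}=\operatorname{prox}_{\frac{\tau\gamma}{1+\tau}g}\Big(\frac{x^k-\tau\sum_{i=1}^m B_i^*y_i^k+\tau\big(x^k-\gamma\nabla f(x^k)\big)}{1+\tau}\Big),$$ $$y_i^{k+1}=\gamma\operatorname{prox}_{\frac{\sigma}{\gamma}h_i^*}\Big(\frac1{\gamma}\big(y_i^k+\sigma B_i(2x^{k+1}-x^k)\big)\Big),\quad i=1,\dots,m.$$ Then $\{x^k\}$ converges weakly to a solution of (P).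
   Context: Standing assumptions: $H$ and $G_1,\dots,G_m$ are real Hilbert spaces; $f:H\to\mathbb R$ is convex and differentiable with $L$-Lipschitz continuous gradient for some $L\in(0,\infty)$; $g\in\Gamma_0(H)$; $h_i\in\Gamma_0(G_i)$ and $B_i:H\to G_i$ is a bounded linear operator for each $i$; there exists $\hat x\in H$ with $0\in\nabla f(\hat x)+\partial g(\hat x)+\sum_{i=1}^m B_i^*\partial h_i(B_i\hat x)$. $\Gamma_0(X)$ is the set of proper lsc convex functions on $X$; $\operatorname{prox}_{\lambda\varphi}(u)=\arg\min_x\{\tfrac12\|x-u\|^2+\lambda\varphi(x)\}$; $\varphi^*$ is the Fenchel conjugate; $B_i^*$ is the adjoint of $B_i$ and $\|B_i\|$ its operator norm. *)

(* Defs.v *)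
From Stdlib Require Import Reals Lra ClassicalEpsilon.
Open Scope R_scope.
Set Implicit Arguments.

Record Hilbert := {
  hT :> Type;
  hzero : hT;
  hadd : hT -> hT -> hT;
  hopp : hT -> hT;
  hscal : R -> hT -> hT;
  hinner : hT -> hT -> R;
  hadd_assoc : forall x y z, hadd x (hadd y z) = hadd (hadd x y) z;
  hadd_comm : forall x y, hadd x y = hadd y x;
  hadd_0 : forall x, hadd hzero x = x;
  hadd_opp : forall x, hadd (hopp x) x = hzero;
  hscal_assoc : forall a b x, hscal a (hscal b x) = hscal (a * b) x;
  hscal_1 : forall x, hscal 1 x = x;
  hscal_distr_v : forall a x y, hscal a (hadd x y) = hadd (hscal a x) (hscal a y);
  hscal_distr_s : forall a b x, hscal (a + b) x = hadd (hscal a x) (hscal b x);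
  hinner_sym : forall x y, hinner x y = hinner y x;
  hinner_add : forall x y z, hinner (hadd x y) z = hinner x z + hinner y z;
  hinner_scal : forall a x y, hinner (hscal a x) y = a * hinner x y;
  hinner_pos : forall x, 0 <= hinner x x;
  hinner_def : forall x, hinner x x = 0 -> x = hzero;
  hcomplete : forall u : nat -> hT,
    (forall eps, 0 < eps -> exists N, forall p q, (N <= p)%nat -> (N <= q)%nat ->
        sqrt (hinner (hadd (u p) (hopp (u q))) (hadd (u p) (hopp (u q)))) < eps) ->
    exists l, forall eps, 0 < eps -> exists N, forall n, (N <= n)%nat ->
        sqrt (hinner (hadd (u n) (hopp l)) (hadd (u n) (hopp l))) < eps
}.
Arguments hzero {h}.
Arguments hadd {h}.
Arguments hopp {h}.
Arguments hscal {h}.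
Arguments hinner {h}.

Definition hsub {H : Hilbert} (x y : H) : H := hadd x (hopp y).
Definition hnorm {H : Hilbert} (x : H) : R := sqrt (hinner x x).

Declare Scope hilb_scope.
Delimit Scope hilb_scope with H.
Infix "+" := hadd : hilb_scope.
Infix "-" := hsub : hilb_scope.
Infix "*:" := hscal (at level 40) : hilb_scope.

Fixpoint hsum {H : Hilbert} (n : nat) (F : nat -> H) : H :=
  match n with O => hzero | S n' => hadd (hsum n' F) (F n') end.
Fixpoint rsum (n : nat) (F : nat -> R) : R :=
  match n with O => 0 | S n' => rsum n' F + F n' end.

Inductive ereal := Fin (a : R) | PInf.
Definition ele (u v : ereal) : Prop :=
  match u, v with
  | Fin a, Fin b => a <= b
  | _, PInf => True
  | PInf, Fin _ => False
  end.
Definition eadd (u v : ereal) : ereal :=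
  match u, v with Fin a, Fin b => Fin (a + b) | _, _ => PInf end.
(* multiplication by a positive scalar *)
Definition escal (t : R) (u : ereal) : ereal :=
  match u with Fin a => Fin (t * a) | PInf => PInf end.
Fixpoint esum (n : nat) (F : nat -> ereal) : ereal :=
  match n with O => Fin 0 | S n' => eadd (esum n' F) (F n') end.

(* supremum of a nonempty set of reals, in R ∪ {+∞} *)
Definition is_esup (E : R -> Prop) (v : ereal) : Prop :=
  (v = PInf /\ forall M, exists r, E r /\ M < r) \/
  (exists l, v = Fin l /\ is_lub E l).
Definition esup (E : R -> Prop) : ereal := epsilon (inhabits PInf) (is_esup E).

Definition hconverges {H : Hilbert} (u : nat -> H) (l : H) : Prop :=
  forall eps, 0 < eps -> exists N, forall n, (N <= n)%nat -> hnorm (hsub (u n) l) < eps.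

Definition proper {H : Hilbert} (phi : H -> ereal) : Prop := exists x, phi x <> PInf.
Definition convex {H : Hilbert} (phi : H -> ereal) : Prop :=
  forall x y t, 0 < t < 1 ->
    ele (phi (hadd (hscal t x) (hscal (1 - t) y))) (eadd (escal t (phi x)) (escal (1 - t) (phi y))).
(* lower semicontinuity = closed sublevel sets (sequentially, in norm) *)
Definition lsc {H : Hilbert} (phi : H -> ereal) : Prop :=
  forall (r : R) (u : nat -> H) (l : H),
    hconverges u l -> (forall n, ele (phi (u n)) (Fin r)) -> ele (phi l) (Fin r).
Definition Gamma0 {H : Hilbert} (phi : H -> ereal) : Prop :=
  proper phi /\ convex phi /\ lsc phi.

Definition convex_real {H : Hilbert} (f : H -> R) : Prop :=
  forall x y t, 0 < t < 1 ->
    f (hadd (hscal t x) (hscal (1 - t) y)) <= t * f x + (1 - t) * f y.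

Definition is_gradient {H : Hilbert} (f : H -> R) (gf : H -> H) : Prop :=
  forall x eps, 0 < eps -> exists delta, 0 < delta /\
    forall d : H, hnorm d < delta ->
      Rabs (f (hadd x d) - f x - hinner (gf x) d) <= eps * hnorm d.

Definition is_prox {H : Hilbert} (lam : R) (phi : H -> ereal) (u p : H) : Prop :=
  forall x : H,
    ele (eadd (Fin (/2 * hnorm (hsub p u) ^ 2)) (escal lam (phi p)))
        (eadd (Fin (/2 * hnorm (hsub x u) ^ 2)) (escal lam (phi x))).
(* the (unique, for phi in Γ0 and lam > 0) proximal point *)
Definition prox {H : Hilbert} (lam : R) (phi : H -> ereal) (u : H) : H :=
  epsilon (inhabits u) (is_prox lam phi u).

Definition fconj {H : Hilbert} (phi : H -> ereal) (y : H) : ereal :=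
  esup (fun r => exists x a, phi x = Fin a /\ r = hinner x y - a).

Definition subdiff {H : Hilbert} (phi : H -> ereal) (x u : H) : Prop :=
  exists a, phi x = Fin a /\
    forall z, ele (Fin (a + hinner u (hsub z x))) (phi z).

Definition bounded_linear {H G : Hilbert} (B : H -> G) : Prop :=
  (forall x y, B (hadd x y) = hadd (B x) (B y)) /\
  (forall a x, B (hscal a x) = hscal a (B x)) /\
  (exists c, forall x, hnorm (B x) <= c * hnorm x).
Definition is_adjoint {H G : Hilbert} (B : H -> G) (Bs : G -> H) : Prop :=
  forall x y, hinner (B x) y = hinner x (Bs y).
Definition is_opnorm {H G : Hilbert} (B : H -> G) (c : R) : Prop :=
  is_lub (fun r => exists x, hnorm x <= 1 /\ r = hnorm (B x)) c.

Definition weak_cv {H : Hilbert} (u : nat -> H) (l : H) : Prop :=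
  forall z : H, Un_cv (fun k => hinner (u k) z) (hinner l z).

(* Main.v *)
Require Import Defs.
From Stdlib Require Import Reals Lra Lia Psatz ClassicalEpsilon Classical.
Open Scope R_scope.

(** In the scaled dual variable [v = y / gamma] the iteration is the Condat-Vu
    scheme with [al = (1 + tau) / (tau gamma)] and [be = gamma / sigma]: for
    [q = be (v - v+) + B (2 x+ - x)],
    [al (x - x+) - B* v - grad f x] is a subgradient of [g] at [x+] and [v+] is a
    subgradient of [h] at [q].  Here the [G i] are merged into one product space,
    with [h] the separable sum.  The hypotheses on the step sizes say that
    [(al - L/2) be > |B|^2], so by Baillon-Haddad the iterates are Fejer monotone
    with respect to the saddle points in the coercive form
    [al |x|^2 - 2 <B x, v> + be |v|^2].

    Weak compactness and Mazur's lemma are replaced by the points common to the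
    closed convex hulls of all tails of the sequence [(x+, v+, q)].  They exist by
    minimal norm arguments, they are saddle points because the limiting
    inequality has closed convex sublevel sets, and Opial's argument shows that
    there is only one; this gives weak convergence. *)

(** * Inner product calculus *)

Section HilbertBasics.
Context {H : Hilbert}.
Implicit Types x y z u v : H.

Lemma hadd_0_r x : hadd x hzero = x.
Proof. rewrite hadd_comm; apply hadd_0. Qed.

Lemma hinner_0_l y : hinner hzero y = 0.
Proof.
  pose proof (hinner_add H hzero hzero y) as E. rewrite hadd_0 in E. lra.
Qed.

Lemma hinner_opp_l x y : hinner (hopp x) y = - hinner x y.
Proof.
  pose proof (hinner_add H (hopp x) x y) as E.
  rewrite hadd_opp, hinner_0_l in E. lra.
Qed.

Lemma hinner_sub_l x y z : hinner (hsub x y) z = hinner x z - hinner y z.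
Proof. unfold hsub. rewrite hinner_add, hinner_opp_l. ring. Qed.

Lemma hinner_0_r y : hinner y hzero = 0.
Proof. rewrite hinner_sym; apply hinner_0_l. Qed.

Lemma hinner_add_r x y z : hinner z (hadd x y) = hinner z x + hinner z y.
Proof. rewrite !(hinner_sym H z); apply hinner_add. Qed.

Lemma hinner_opp_r x y : hinner y (hopp x) = - hinner y x.
Proof. rewrite !(hinner_sym H y); apply hinner_opp_l. Qed.

Lemma hinner_sub_r x y z : hinner z (hsub x y) = hinner z x - hinner z y.
Proof. rewrite !(hinner_sym H z); apply hinner_sub_l. Qed.

Lemma hinner_scal_r a x y : hinner y (hscal a x) = a * hinner y x.
Proof. rewrite !(hinner_sym H y); apply hinner_scal. Qed.
End HilbertBasics.

#[export] Hint Rewrite @hinner_0_l @hinner_0_r @hinner_opp_l @hinner_opp_r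
  @hinner_add @hinner_add_r @hinner_sub_l @hinner_sub_r
  @hinner_scal @hinner_scal_r : hinner.

(* Orients [hinner a b] and [hinner b a] the same way, so that [ring] and [lra]
   see a single atom. *)
Ltac hinner_orient :=
  repeat match goal with
  | |- context [@hinner ?H ?a ?b] =>
      match goal with
      | |- context [@hinner H b a] =>
          tryif constr_eq a b then fail else rewrite (hinner_sym H b a)
      end
  end.
Ltac hexpand := autorewrite with hinner; hinner_orient.

Section HilbertMetric.
Context {H : Hilbert}.
Implicit Types x y z u v : H.

Lemma hinner_ext x y : (forall z, hinner x z = hinner y z) -> x = y.
Proof.
  intros E.
  assert (E0 : hsub x y = hzero).
  { apply hinner_def. rewrite hinner_sub_l, E. ring. }
  assert (E1 : hadd (hsub x y) y = hadd hzero y) by now rewrite E0.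
  unfold hsub in E1. rewrite <- hadd_assoc, hadd_opp, hadd_0_r, hadd_0 in E1. exact E1.
Qed.

Lemma hnorm_sq x : hnorm x ^ 2 = hinner x x.
Proof. unfold hnorm. rewrite <- Rsqr_pow2. apply Rsqr_sqrt, hinner_pos. Qed.

Lemma hnorm_pos x : 0 <= hnorm x.
Proof. apply sqrt_pos. Qed.

Lemma hnorm_lt x e : 0 < e -> (hnorm x < e <-> hinner x x < e ^ 2).
Proof.
  intros He. rewrite <- hnorm_sq. pose proof (hnorm_pos x). split; intros; nra.
Qed.

Lemma hnorm_scal a x : hnorm (hscal a x) = Rabs a * hnorm x.
Proof.
  unfold hnorm. rewrite hinner_scal, hinner_scal_r.
  replace (a * (a * hinner x x)) with (Rsqr a * hinner x x) by (unfold Rsqr; ring).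
  rewrite sqrt_mult; [now rewrite sqrt_Rsqr_abs | apply Rle_0_sqr | apply hinner_pos].
Qed.

(** Expanding the squared norm of [<y,y> x - <x,y> y] avoids a division; it yields the claim
    multiplied by [<y,y>], whence the separate case [y = 0]. *)
Lemma cauchy_schwarz x y : hinner x y ^ 2 <= hinner x x * hinner y y.
Proof.
  destruct (Req_dec (hinner y y) 0) as [E|E].
  - apply hinner_def in E. subst y. hexpand. lra.
  - pose proof (hinner_pos H y).
    pose proof (hinner_pos H (hsub (hscal (hinner y y) x) (hscal (hinner x y) y))) as P.
    revert P. hexpand. intros P.
    assert (0 <= hinner y y * (hinner x x * hinner y y - hinner x y ^ 2)) by nra.
    assert (0 < hinner y y) by lra. nra.
Qed.

Lemma hinner_young x y t : 0 < t ->
  2 * hinner x y <= t * hinner x x + / t * hinner y y.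
Proof.
  intros Ht. pose proof (hinner_pos H (hsub (hscal t x) y)) as P.
  revert P; hexpand; intros P.
  apply (Rmult_le_reg_l t); [lra|].
  replace (t * (t * hinner x x + / t * hinner y y))
    with (t * t * hinner x x + hinner y y) by (field; lra). nra.
Qed.
End HilbertMetric.

(** Vector identities are tested against an arbitrary vector and become real field identities; the
    conditions that denominators are nonzero are left to the caller. *)
Ltac hvec := apply hinner_ext; intro; autorewrite with hinner; try field.

(** * Limits of real sequences *)

Lemma Un_cv_null_of_le (a b : nat -> R) :
  (forall n, 0 <= a n <= b n) -> Un_cv b 0 -> Un_cv a 0.
Proof.
  intros Hab Hb e He. destruct (Hb e He) as [N HN]. exists N. intros n Hn.
  specialize (HN n Hn). specialize (Hab n). unfold Rdist in *.
  rewrite Rminus_0_r in *. rewrite Rabs_pos_eq in * by lra. lra.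
Qed.

Lemma Un_cv_const c : Un_cv (fun _ => c) c.
Proof. intros e He. exists 0%nat. intros. unfold Rdist. now rewrite Rminus_diag, Rabs_R0. Qed.

Lemma Un_cv_ext (a b : nat -> R) l : (forall n, a n = b n) -> Un_cv a l -> Un_cv b l.
Proof. intros E Ha e He. destruct (Ha e He) as [N HN]. exists N. intros. rewrite <- E. auto. Qed.

Lemma Un_cv_shift (a : nat -> R) l : Un_cv a l -> Un_cv (fun n => a (S n)) l.
Proof. intros Ha e He. destruct (Ha e He) as [N HN]. exists N. intros; apply HN; lia. Qed.

Lemma Un_cv_unshift (a : nat -> R) l : Un_cv (fun n => a (S n)) l -> Un_cv a l.
Proof.
  intros Ha e He. destruct (Ha e He) as [N HN]. exists (S N). intros [|n] Hn; [lia|].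
  apply HN; lia.
Qed.

Lemma Un_cv_scal c (a : nat -> R) l : Un_cv a l -> Un_cv (fun n => c * a n) (c * l).
Proof. intros Ha. apply (CV_mult (fun _ => c)); [apply Un_cv_const | exact Ha]. Qed.

Lemma Un_cv_eventually_le (a : nat -> R) l e :
  Un_cv a l -> 0 < e -> exists N, forall n, (N <= n)%nat -> l - e <= a n <= l + e.
Proof.
  intros Ha He. destruct (Ha e He) as [N HN]. exists N. intros n Hn.
  specialize (HN n Hn). unfold Rdist in HN. apply Rabs_def2 in HN. lra.
Qed.

Lemma Un_cv_inv_S : Un_cv (fun n => / (INR n + 1)) 0.
Proof.
  intros e He. destruct (cv_infty_cv_0 (fun n => INR n + 1)) with (eps := e) as [N HN]; auto.
  - intros M. destruct (INR_unbounded M) as [N HN]. exists N. intros n Hn.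
    apply le_INR in Hn. lra.
  - exists N. exact HN.
Qed.

(** * Norm convergence, through squared norms *)

Section Convergence.
Context {H : Hilbert}.
Implicit Types (u v : nat -> H) (l : H).

Lemma hconverges_sq u l :
  hconverges u l <-> Un_cv (fun n => hinner (hsub (u n) l) (hsub (u n) l)) 0.
Proof.
  split; intros Hu e He.
  - destruct (Hu (sqrt e)) as [N HN]; [now apply sqrt_lt_R0|].
    exists N. intros n Hn. specialize (HN n Hn).
    apply hnorm_lt in HN; [|now apply sqrt_lt_R0].
    rewrite <- Rsqr_pow2, Rsqr_sqrt in HN by lra.
    unfold Rdist. rewrite Rminus_0_r, Rabs_pos_eq; [exact HN | apply hinner_pos].
  - destruct (Hu (e ^ 2)) as [N HN]; [nra|].
    exists N. intros n Hn. specialize (HN n Hn). apply hnorm_lt; [exact He|].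
    unfold Rdist in HN. rewrite Rminus_0_r, Rabs_pos_eq in HN; [exact HN | apply hinner_pos].
Qed.

Lemma cauchy_converges u :
  (forall e, 0 < e -> exists N, forall p q, (N <= p)%nat -> (N <= q)%nat ->
     hinner (hsub (u p) (u q)) (hsub (u p) (u q)) < e) ->
  exists l, hconverges u l.
Proof.
  intros Hu. destruct (hcomplete H u) as [l Hl].
  - intros e He. destruct (Hu (e ^ 2)) as [N HN]; [nra|].
    exists N. intros p q Hp Hq. apply (hnorm_lt (hsub (u p) (u q)) e He). auto.
  - exists l. exact Hl.
Qed.

Lemma hconverges_shift u l k : hconverges u l -> hconverges (fun n => u (k + n)%nat) l.
Proof. intros Hu e He. destruct (Hu e He) as [N HN]. exists N. intros; apply HN; lia. Qed.

Lemma hconverges_reindex u l (s : nat -> nat) :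
  (forall n, (n <= s n)%nat) -> hconverges u l -> hconverges (fun n => u (s n)) l.
Proof.
  intros Hs Hu e He. destruct (Hu e He) as [N HN]. exists N. intros n Hn; apply HN.
  specialize (Hs n). lia.
Qed.

Lemma Un_cv_hinner_null u v (M : R) :
  (forall n, hinner (u n) (u n) <= M) ->
  Un_cv (fun n => hinner (v n) (v n)) 0 -> Un_cv (fun n => hinner (u n) (v n)) 0.
Proof.
  intros HM Hv e He.
  assert (HM0 : 0 <= M) by (eapply Rle_trans; [apply hinner_pos | apply (HM 0%nat)]).
  (* Cauchy-Schwarz bounds the squared pairing by [M] times the null sequence; [+ 1] keeps the
     denominator positive when [M = 0]. *)
  destruct (Hv (e ^ 2 / (M + 1))) as [N HN]; [apply Rdiv_lt_0_compat; nra|].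
  exists N. intros n Hn. specialize (HN n Hn). unfold Rdist in *. rewrite Rminus_0_r in *.
  pose proof (hinner_pos H (v n)). rewrite Rabs_pos_eq in HN by lra.
  pose proof (cauchy_schwarz (u n) (v n)) as C. specialize (HM n).
  pose proof (hinner_pos H (u n)).
  assert (hinner (u n) (v n) ^ 2 < e ^ 2).
  { apply (Rmult_lt_compat_r (M + 1)) in HN; [|lra].
    replace (e ^ 2 / (M + 1) * (M + 1)) with (e ^ 2) in HN by (field; lra). nra. }
  rewrite <- pow2_abs in H2. pose proof (Rabs_pos (hinner (u n) (v n))). nra.
Qed.

Lemma hconverges_hinner u l c : hconverges u l ->
  Un_cv (fun n => hinner (u n) c) (hinner l c).
Proof.
  intros Hu. apply hconverges_sq in Hu.
  assert (E : Un_cv (fun n => hinner c (hsub (u n) l)) 0).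
  { apply Un_cv_hinner_null with (M := hinner c c); [intros; lra | exact Hu]. }
  replace (hinner l c) with (0 + hinner l c) by ring.
  apply Un_cv_ext with (a := fun n => hinner c (hsub (u n) l) + hinner l c).
  - intros n. hexpand. ring.
  - apply CV_plus; [exact E | apply Un_cv_const].
Qed.

(** Expands [|u - c|^2] around [l]: a null square, a term linear in [u], and a constant. *)
Lemma hconverges_hnorm_sub u l c : hconverges u l ->
  Un_cv (fun n => hinner (hsub (u n) c) (hsub (u n) c)) (hinner (hsub l c) (hsub l c)).
Proof.
  intros Hu. pose proof (hconverges_hinner _ _ (hsub l c) Hu) as H1.
  apply hconverges_sq in Hu.
  pose proof (CV_plus _ _ _ _ Hu (Un_cv_scal 2 _ _ H1)) as H2.
  pose proof (CV_plus _ _ _ _ H2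
    (Un_cv_const (hinner (hsub l c) (hsub l c) - 2 * hinner l (hsub l c)))) as H3.
  replace (hinner (hsub l c) (hsub l c)) with
    (0 + 2 * hinner l (hsub l c)
     + (hinner (hsub l c) (hsub l c) - 2 * hinner l (hsub l c))) by ring.
  revert H3. apply Un_cv_ext. intros n. hexpand. ring.
Qed.
End Convergence.

Lemma le_of_le_add_eps a b : (forall e, 0 < e -> a <= b + e) -> a <= b.
Proof. intros E. destruct (Rle_dec a b); [assumption|]. specialize (E ((a - b) / 2)). lra. Qed.

Lemma archimed_inv e : 0 < e -> exists N, forall n, (N <= n)%nat -> / (INR n + 1) < e.
Proof.
  intros He. destruct (Un_cv_inv_S e He) as [N HN]. exists N. intros n Hn.
  specialize (HN n Hn). unfold Rdist in HN. rewrite Rminus_0_r in HN.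
  apply Rabs_def2 in HN. lra.
Qed.

Lemma inv_INR_S_pos n : 0 < / (INR n + 1).
Proof. apply Rinv_0_lt_compat. pose proof (pos_INR n). lra. Qed.

(** Keeps the proximal objective bounded below. Hahn-Banach would provide it for every function in
    [Gamma0]; here the subgradients at the given solution do. *)
Definition affine_minorant {H : Hilbert} (phi : H -> ereal) : Prop :=
  exists c w, forall z, ele (Fin (c + hinner w z)) (phi z).

Lemma subdiff_affine_minorant {H : Hilbert} (phi : H -> ereal) x u :
  subdiff phi x u -> affine_minorant phi.
Proof.
  intros (a & Ea & Hs). exists (a - hinner u x), u. intros z. specialize (Hs z).
  destruct (phi z); simpl in *; [|trivial]. revert Hs. hexpand. lra.
Qed.

Lemma convex_le {H : Hilbert} (phi : H -> ereal) x y t a b :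
  convex phi -> 0 < t < 1 -> ele (phi x) (Fin a) -> ele (phi y) (Fin b) ->
  ele (phi (hadd (hscal t x) (hscal (1 - t) y))) (Fin (t * a + (1 - t) * b)).
Proof.
  intros Hc Ht Ha Hb. specialize (Hc x y t Ht).
  destruct (phi x), (phi y); simpl in *; try contradiction.
  destruct (phi (hadd _ _)); simpl in *; [|trivial]. nra.
Qed.

(** * Proximal points: existence, optimality condition, uniqueness *)

Section Prox.
Context {H : Hilbert} (phi : H -> ereal).
Context (Hproper : proper phi) (Hconv : convex phi) (Hlsc : lsc phi).

Section Existence.
Context (lam : R) (u : H).
Context (Hlam : 0 < lam) (Hmin : affine_minorant phi).

Let J (x : H) (a : R) := / 2 * hinner (hsub x u) (hsub x u) + lam * a.

(** Replace [phi] by its affine minorant and complete the square, which is that of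
    [x - u + lam w]. *)
Lemma prox_objective_bounded : exists c, forall x a, phi x = Fin a -> c <= J x a.
Proof.
  destruct Hmin as (c & w & Hcw).
  exists (lam * (c + hinner w u) - / 2 * lam ^ 2 * hinner w w). intros x a Ea.
  specialize (Hcw x). rewrite Ea in Hcw. simpl in Hcw. unfold J.
  pose proof (hinner_pos H (hadd (hsub x u) (hscal lam w))) as P. revert P.
  hexpand. intros P. nra.
Qed.

Lemma prox_minimizing_sequence : exists mu (v : nat -> H) (a : nat -> R),
  (forall x b, phi x = Fin b -> mu <= J x b) /\
  (forall n, phi (v n) = Fin (a n) /\ J (v n) (a n) <= mu + / (INR n + 1)).
Proof.
  destruct prox_objective_bounded as [c Hc].
  (* [completeness] provides suprema, so it is applied to [- J]; the infimum is [- nu]. *)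
  destruct (completeness (fun r => exists x a, phi x = Fin a /\ r = - J x a)) as [nu [Hub Hlub]].
  - exists (- c). intros r (x & a & Ea & ->). specialize (Hc x a Ea). lra.
  - destruct Hproper as [x Hx]. destruct (phi x) as [a|] eqn:E; [|congruence].
    exists (- J x a), x, a. auto.
  - assert (Hn : forall n, exists p : H * R,
      phi (fst p) = Fin (snd p) /\ J (fst p) (snd p) <= - nu + / (INR n + 1)).
    { intros n. apply NNPP. intros Hno. pose proof (inv_INR_S_pos n) as Hp.
      assert (nu <= nu - / (INR n + 1)); [|lra]. apply Hlub. intros r (x & a & Ea & ->).
      apply Rnot_lt_le. intros Hlt. apply Hno. exists (x, a). simpl. split; [exact Ea | lra]. }
    apply ClassicalEpsilon.choice in Hn. destruct Hn as [s Hs].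
    exists (- nu), (fun n => fst (s n)), (fun n => snd (s n)). split; [|exact Hs].
    intros x b Eb. assert (- J x b <= nu) by (apply Hub; eauto). lra.
Qed.

(** The quadratic term makes a minimizing sequence Cauchy, by comparing the values at two of its
    points with the value at their midpoint. Lower semicontinuity then gives minimality of the
    limit. *)
Lemma is_prox_exists : exists p, is_prox lam phi u p.
Proof.
  destruct prox_minimizing_sequence as (mu & v & a & Hmu & Hv).
  assert (Hpar : forall p q,
    hinner (hsub (v p) (v q)) (hsub (v p) (v q)) <= 4 * (/ (INR p + 1) + / (INR q + 1))).
  { intros p q. destruct (Hv p) as [Ep Jp], (Hv q) as [Eq Jq].
    assert (Hle : ele (phi (hadd (hscal (/ 2) (v p)) (hscal (1 - / 2) (v q))))
       (Fin (/ 2 * a p + (1 - / 2) * a q))).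
    { apply convex_le; [exact Hconv | lra | rewrite Ep; simpl; lra | rewrite Eq; simpl; lra]. }
    destruct (phi (hadd _ _)) as [b|] eqn:Eb; simpl in Hle; [|contradiction].
    apply Hmu in Eb. unfold J in *. revert Eb Jp Jq. hexpand. nra. }
  destruct (cauchy_converges v) as [l Hl].
  { intros e He. destruct (archimed_inv (e / 8)) as [N HN]; [lra|].
    exists N. intros p q Hp Hq. specialize (Hpar p q).
    pose proof (HN p Hp). pose proof (HN q Hq). lra. }
  (* [lsc] concerns sublevel sets of a fixed level, so the bound reaches [l] only up to [e]: half of
     it pays for the quadratic term, half for the excess over [mu]. *)
  assert (Hle : forall e, 0 < e ->
    ele (phi l) (Fin (/ lam * (mu + e - / 2 * hinner (hsub l u) (hsub l u))))).
  { intros e He.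
    destruct (Un_cv_eventually_le _ _ e (hconverges_hnorm_sub _ _ u Hl)) as [N1 HN1]; [lra|].
    destruct (archimed_inv (e / 2)) as [N2 HN2]; [lra|].
    apply (Hlsc _ (fun n => v (N1 + N2 + n)%nat)).
    - now apply hconverges_shift.
    - intros n. destruct (Hv (N1 + N2 + n)%nat) as [En Jn]. rewrite En. simpl.
      specialize (HN1 (N1 + N2 + n)%nat ltac:(lia)).
      specialize (HN2 (N1 + N2 + n)%nat ltac:(lia)). unfold J in Jn.
      apply (Rmult_le_reg_l lam); [lra|]. rewrite <- Rmult_assoc, Rinv_r by lra. lra. }
  destruct (phi l) as [b|] eqn:El; [|exact (False_ind _ (Hle 1 Rlt_0_1))].
  exists l. intros x. rewrite El, !hnorm_sq. destruct (phi x) as [d|] eqn:Ex; simpl; [|trivial].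
  apply Hmu in Ex. unfold J in Ex. eapply Rle_trans; [|exact Ex].
  apply le_of_le_add_eps. intros e He. specialize (Hle e He). simpl in Hle.
  apply (Rmult_le_compat_l lam) in Hle; [|lra]. rewrite <- Rmult_assoc, Rinv_r in Hle by lra. lra.
Qed.
End Existence.

(** Fermat's rule: compare [p] with [t z + (1 - t) p], divide by [t] and let [t] tend to 0. *)
Lemma is_prox_subdiff lam u p :
  0 < lam -> is_prox lam phi u p -> subdiff phi p (hscal (/ lam) (hsub u p)).
Proof.
  intros Hlam Hp. destruct (phi p) as [a|] eqn:Ea.
  2: { destruct Hproper as [x Hx]. specialize (Hp x). rewrite Ea in Hp.
       destruct (phi x); simpl in Hp; [contradiction | congruence]. }
  exists a. split; [exact Ea|]. intros z. destruct (phi z) as [b|] eqn:Ez; simpl; [|trivial].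
  apply (Rmult_le_reg_l lam); [exact Hlam|].
  assert (E : lam * (a + hinner (hscal (/ lam) (hsub u p)) (hsub z p))
     = lam * a + hinner (hsub u p) (hsub z p)) by (rewrite hinner_scal; field; lra).
  rewrite E. clear E. set (d := hinner (hsub z p) (hsub z p)).
  assert (Hd : 0 <= d) by apply hinner_pos.
  assert (Ht : forall t, 0 < t < 1 ->
    lam * a + hinner (hsub u p) (hsub z p) <= lam * b + t * d).
  { intros t Ht. pose proof (convex_le phi z p t b a Hconv Ht) as Hc.
    rewrite Ez, Ea in Hc. specialize (Hc (Rle_refl _) (Rle_refl _)).
    specialize (Hp (hadd (hscal t z) (hscal (1 - t) p))).
    destruct (phi (hadd _ _)) as [c|]; simpl in Hc; [|contradiction].
    rewrite Ea, !hnorm_sq in Hp. simpl in Hp.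
    assert (t * (lam * a + hinner (hsub u p) (hsub z p)) <= t * (lam * b + t * d)); [|nra].
    assert (lam * c <= lam * (t * b + (1 - t) * a)) by (apply Rmult_le_compat_l; lra).
    unfold d. revert Hp. hexpand. intros Hp.
    assert (0 <= t * t * d) by (apply Rmult_le_pos; nra).
    unfold d in *. revert H1. hexpand. nra. }
  apply le_of_le_add_eps. intros e He.
  (* Lies in [(0,1)] and makes [t * d <= e], also when [d = 0]. *)
  set (t := Rmin (/ 2) (e / (d + 1))).
  assert (0 < e / (d + 1)) by (apply Rdiv_lt_0_compat; lra).
  assert (Ht0 : 0 < t < 1) by (unfold t, Rmin; destruct (Rle_dec _ _); lra).
  specialize (Ht t Ht0).
  assert (t * d <= e); [|lra].
  assert (t <= e / (d + 1)) by apply Rmin_r.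
  assert (t * (d + 1) <= e / (d + 1) * (d + 1)) by (apply Rmult_le_compat_r; lra).
  replace (e / (d + 1) * (d + 1)) with e in H2 by (field; lra). lra.
Qed.

Lemma prox_subdiff lam u :
  0 < lam -> affine_minorant phi ->
  subdiff phi (prox lam phi u) (hscal (/ lam) (hsub u (prox lam phi u))).
Proof.
  intros Hlam Hmin. apply is_prox_subdiff; [exact Hlam|].
  unfold prox. apply epsilon_spec. now apply is_prox_exists.
Qed.
End Prox.

(** The subgradient inequality makes the objective grow by at least half of [|z - p|^2] away from
    [p]. Uniqueness is included in order to identify the point that [epsilon] picks in [prox]. *)
Lemma is_prox_of_subdiff {H : Hilbert} (phi : H -> ereal) lam u p q :
  0 < lam -> subdiff phi p (hscal (/ lam) (hsub u p)) ->
  is_prox lam phi u p /\ (is_prox lam phi u q -> q = p).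
Proof.
  intros Hlam (a & Ea & Hs).
  assert (E : forall z b, phi z = Fin b ->
    / 2 * hinner (hsub p u) (hsub p u) + lam * a + / 2 * hinner (hsub z p) (hsub z p)
      <= / 2 * hinner (hsub z u) (hsub z u) + lam * b).
  { intros z b Ez. specialize (Hs z). rewrite Ez in Hs. simpl in Hs.
    apply (Rmult_le_compat_l lam) in Hs; [|lra].
    rewrite hinner_scal, Rmult_plus_distr_l, <- Rmult_assoc, Rinv_r, Rmult_1_l in Hs by lra.
    revert Hs. hexpand. lra. }
  split.
  - intros z. rewrite Ea, !hnorm_sq. destruct (phi z) as [b|] eqn:Ez; simpl; [|trivial].
    specialize (E z b Ez). pose proof (hinner_pos H (hsub z p)). lra.
  - intros Hq. specialize (Hq p). rewrite Ea, !hnorm_sq in Hq.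
    destruct (phi q) as [b|] eqn:Eq; simpl in Hq; [|contradiction].
    specialize (E q b Eq). pose proof (hinner_pos H (hsub q p)).
    assert (E0 : hsub q p = hzero) by (apply hinner_def; lra).
    apply hinner_ext. intros z.
    assert (hinner (hsub q p) z = 0) by (rewrite E0; apply hinner_0_l).
    rewrite hinner_sub_l in *. lra.
Qed.

(** * Fenchel conjugates and Moreau's decomposition *)

Lemma fconj_spec {H : Hilbert} (phi : H -> ereal) y :
  proper phi ->
  is_esup (fun r => exists x a, phi x = Fin a /\ r = hinner x y - a) (fconj phi y).
Proof.
  intros [x Hx]. unfold fconj, esup. apply epsilon_spec.
  set (E := fun r => exists x a, phi x = Fin a /\ r = hinner x y - a).
  (* Properness makes [E] nonempty, so it has a real supremum unless it is unbounded above. *)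
  destruct (classic (bound E)) as [Hb|Hb].
  - destruct (completeness E Hb) as [l Hl].
    + destruct (phi x) as [a|] eqn:Ea; [|congruence]. exists (hinner x y - a), x, a. auto.
    + exists (Fin l). right. exists l. auto.
  - exists PInf. left. split; [reflexivity|]. intros M. apply NNPP. intros Hno.
    apply Hb. exists M. intros r Hr. apply Rnot_lt_le. intros Hlt. apply Hno. eauto.
Qed.

(* The easy half of Fenchel's theorem; it spares the biconjugate theorem because
   the prox of the conjugate is computed from the prox of [phi]. *)
Lemma subdiff_fconj {H : Hilbert} (phi : H -> ereal) p q :
  proper phi -> subdiff phi p q -> subdiff (fconj phi) q p.
Proof.
  intros Hpr (a & Ea & Hs).
  assert (Hlow : forall z, ele (Fin (hinner p z - a)) (fconj phi z)).
  { intros z. destruct (fconj_spec phi z Hpr) as [[-> _]|(l & -> & Hub & _)]; simpl; [trivial|].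
    apply Hub. eauto. }
  exists (hinner p q - a). split.
  - specialize (Hlow q).
    assert (Hupp : forall r, (exists x b, phi x = Fin b /\ r = hinner x q - b) ->
      r <= hinner p q - a).
    { intros r (x & b & Eb & ->). specialize (Hs x). rewrite Eb in Hs. simpl in Hs.
      revert Hs. hexpand. lra. }
    destruct (fconj_spec phi q Hpr) as [[_ HM]|(l & E & Hub & Hlub)].
    + destruct (HM (hinner p q - a)) as (r & Hr & Hlt). specialize (Hupp r Hr). lra.
    + rewrite E in *. simpl in Hlow. f_equal. apply Rle_antisym; [|exact Hlow].
      apply Hlub. exact Hupp.
  - intros z. specialize (Hlow z). destruct (fconj phi z); simpl in *; [|trivial].
    revert Hlow. hexpand. lra.
Qed.

(* Moreau's decomposition: [u = prox_{lam phi*} u + lam p] with [p = prox_{phi/lam}(u/lam)]. *)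
Lemma prox_fconj_subdiff {H : Hilbert} (phi : H -> ereal) lam u :
  Gamma0 phi -> affine_minorant phi -> 0 < lam ->
  subdiff phi (hscal (/ lam) (hsub u (prox lam (fconj phi) u))) (prox lam (fconj phi) u).
Proof.
  intros (Hpr & Hc & Hl) Hmin Hlam.
  assert (Hlam' : 0 < / lam) by now apply Rinv_0_lt_compat.
  pose proof (prox_subdiff phi Hpr Hc Hl (/ lam) (hscal (/ lam) u) Hlam' Hmin) as Hs.
  set (p := prox (/ lam) phi (hscal (/ lam) u)) in *.
  set (q := hsub u (hscal lam p)).
  replace (hscal (/ / lam) (hsub (hscal (/ lam) u) p)) with q in Hs
    by (unfold q; hvec; lra).
  assert (Ep : hscal (/ lam) (hsub u q) = p) by (unfold q; hvec; lra).
  pose proof (subdiff_fconj phi p q Hpr Hs) as Hs'.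
  rewrite <- Ep in Hs'.
  (* [Hs'] is the optimality condition at [q] for the prox of the conjugate, so [q] is that prox. *)
  destruct (is_prox_of_subdiff (fconj phi) lam u q (prox lam (fconj phi) u) Hlam Hs')
    as [Hq Huniq].
  rewrite Huniq; [now rewrite Ep|].
  unfold prox. apply epsilon_spec. eauto.
Qed.

Lemma Rabs_le_bounds a b : Rabs a <= b -> - b <= a <= b.
Proof. unfold Rabs. destruct (Rcase_abs a); lra. Qed.

(** * Differentiable functions, up to Baillon-Haddad for convex ones *)

Section Gradient.
Context {H : Hilbert} (f : H -> R) (gradf : H -> H).
Context (Hgrad : is_gradient f gradf).

Lemma gradient_along x d e : 0 < e -> exists delta, 0 < delta /\ forall t, Rabs t < delta ->
  Rabs (f (hadd x (hscal t d)) - f x - t * hinner (gradf x) d) <= e * Rabs t.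
Proof.
  intros He. pose proof (hnorm_pos d) as Hd.
  (* [hnorm d + 1] in place of [hnorm d] covers the direction [d = 0]. *)
  destruct (Hgrad x (e / (hnorm d + 1))) as (del & Hdel & Hf);
    [apply Rdiv_lt_0_compat; lra|].
  exists (del / (hnorm d + 1)). split; [apply Rdiv_lt_0_compat; lra|].
  intros t Ht. specialize (Hf (hscal t d)). rewrite hnorm_scal, hinner_scal_r in Hf.
  pose proof (Rabs_pos t) as Hat.
  apply (Rmult_lt_compat_r (hnorm d + 1)) in Ht; [|lra].
  replace (del / (hnorm d + 1) * (hnorm d + 1)) with del in Ht by (field; lra).
  eapply Rle_trans; [apply Hf; nra|].
  replace (e / (hnorm d + 1) * (Rabs t * hnorm d))
    with (e * Rabs t * (hnorm d / (hnorm d + 1))) by (field; lra).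
  rewrite <- (Rmult_1_r (e * Rabs t)) at 2. apply Rmult_le_compat_l; [nra|].
  apply (Rmult_le_reg_r (hnorm d + 1)); [lra|].
  replace (hnorm d / (hnorm d + 1) * (hnorm d + 1)) with (hnorm d) by (field; lra). lra.
Qed.

Lemma gradient_line_derivative x d t :
  derivable_pt_lim (fun s => f (hadd x (hscal s d))) t
    (hinner (gradf (hadd x (hscal t d))) d).
Proof.
  intros e He.
  destruct (gradient_along (hadd x (hscal t d)) d (e / 2)) as (del & Hdel & Hf); [lra|].
  exists (mkposreal del Hdel). intros s Hs Hsd. simpl in Hsd. specialize (Hf s Hsd).
  replace (hadd (hadd x (hscal t d)) (hscal s d)) with (hadd x (hscal (t + s) d)) in Hf
    by hvec.
  set (A := f (hadd x (hscal (t + s) d))) in *. set (C := f (hadd x (hscal t d))) in *.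
  set (l := hinner _ d) in *.
  replace ((A - C) / s - l) with ((A - C - s * l) * / s) by (field; exact Hs).
  rewrite Rabs_mult, Rabs_inv. apply Rabs_pos_lt in Hs.
  apply (Rmult_lt_reg_r (Rabs s)); [exact Hs|].
  rewrite Rmult_assoc, Rinv_l, Rmult_1_r by lra. nra.
Qed.

(** Removes the smooth term from a subgradient of [f + g]. On the segment from [x] to [z], [f] is
    linear up to [e * t] and [g] lies below its chord; divide by [t]. *)
Lemma subdiff_sum_gradient (g : H -> ereal) x p a :
  convex g -> g x = Fin a ->
  (forall z, ele (Fin (f x + a + hinner p (hsub z x))) (eadd (Fin (f z)) (g z))) ->
  subdiff g x (hsub p (gradf x)).
Proof.
  intros Hc Ea Hs. exists a. split; [exact Ea|]. intros z.
  destruct (g z) as [b|] eqn:Ez; simpl; [|trivial].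
  apply le_of_le_add_eps. intros e He.
  destruct (gradient_along x (hsub z x) e He) as (del & Hdel & Hf).
  set (t := Rmin (/ 2) (del / 2)).
  assert (Ht : 0 < t < 1 /\ t < del) by (unfold t, Rmin; destruct (Rle_dec _ _); lra).
  destruct Ht as [Ht Htd]. rewrite <- (Rabs_pos_eq t) in Htd by lra.
  specialize (Hf t Htd). rewrite (Rabs_pos_eq t) in Hf by lra. apply Rabs_le_bounds in Hf.
  pose proof (convex_le g z x t b a Hc Ht) as Hle. rewrite Ez, Ea in Hle.
  specialize (Hle (Rle_refl _) (Rle_refl _)).
  replace (hadd (hscal t z) (hscal (1 - t) x)) with (hadd x (hscal t (hsub z x))) in Hle
    by hvec.
  specialize (Hs (hadd x (hscal t (hsub z x)))).
  destruct (g (hadd _ _)) as [c|]; simpl in *; [|contradiction].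
  replace (hsub (hadd x (hscal t (hsub z x))) x) with (hscal t (hsub z x)) in Hs
    by hvec.
  rewrite hinner_scal_r in Hs. rewrite (hinner_sub_l p).
  apply (Rmult_le_reg_l t); [lra|]. nra.
Qed.

Lemma convex_gradient_ineq (Hconv : convex_real f) x z :
  f x + hinner (gradf x) (hsub z x) <= f z.
Proof.
  apply le_of_le_add_eps. intros e He.
  destruct (gradient_along x (hsub z x) e He) as (del & Hdel & Hf).
  set (t := Rmin (/ 2) (del / 2)).
  assert (Ht : 0 < t < 1 /\ t < del) by (unfold t, Rmin; destruct (Rle_dec _ _); lra).
  destruct Ht as [Ht Htd]. rewrite <- (Rabs_pos_eq t) in Htd by lra.
  specialize (Hf t Htd). rewrite (Rabs_pos_eq t) in Hf by lra. apply Rabs_le_bounds in Hf.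
  pose proof (Hconv z x t Ht) as Hle.
  replace (hadd (hscal t z) (hscal (1 - t) x)) with (hadd x (hscal t (hsub z x))) in Hle
    by hvec.
  apply (Rmult_le_reg_l t); [lra|]. nra.
Qed.

Context (L : R) (HL : 0 < L).
Context (Hlip : forall u v, hnorm (hsub (gradf u) (gradf v)) <= L * hnorm (hsub u v)).

(** Mean value theorem on [[0,1]] for [f] along the line minus its quadratic model; the Lipschitz
    bound makes the derivative of this difference nonpositive. *)
Lemma descent_lemma x d :
  f (hadd x d) <= f x + hinner (gradf x) d + L / 2 * hinner d d.
Proof.
  set (F := fun t => f (hadd x (hscal t d))).
  destruct (MVT_cor2 (fun t => F t - (hinner (gradf x) d * t + L / 2 * hinner d d * t ^ 2))
    (fun t => hinner (gradf (hadd x (hscal t d))) d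
              - (hinner (gradf x) d * 1 + L / 2 * hinner d d * (INR 2 * t ^ 1))) 0 1)
    as (c & Ec & Hc); [lra| |].
  - intros c _. apply derivable_pt_lim_minus; [apply gradient_line_derivative|].
    apply derivable_pt_lim_plus; apply derivable_pt_lim_scal;
      [apply derivable_pt_lim_id | apply derivable_pt_lim_pow].
  - assert (E1 : F 1 = f (hadd x d)) by (unfold F; f_equal; hvec).
    assert (E0 : F 0 = f x) by (unfold F; f_equal; hvec).
    rewrite E1, E0 in Ec.
    assert (hinner (hsub (gradf (hadd x (hscal c d))) (gradf x)) d <= L * c * hinner d d).
    { set (D := hsub _ _).
      assert (HD : hnorm D <= L * (c * hnorm d)).
      { eapply Rle_trans; [apply Hlip|].
        replace (hsub (hadd x (hscal c d)) x) with (hscal c d) by hvec.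
        rewrite hnorm_scal, Rabs_pos_eq by lra. lra. }
      pose proof (cauchy_schwarz D d) as C. pose proof (hnorm_pos d). pose proof (hnorm_pos D).
      rewrite <- !hnorm_sq in *.
      assert (hinner D d <= hnorm D * hnorm d).
      { apply Rnot_lt_le. intros Hlt. assert (0 <= hnorm D * hnorm d) by nra. nra. }
      nra. }
    rewrite hinner_sub_l in H0. simpl in Ec. nra.
Qed.

Context (Hconv : convex_real f).

(** Take the gradient step [y - D / L] for [f] minus its tangent at [x]: the descent lemma at [y]
    bounds the value of [f] there from above, convexity at [x] from below. *)
Lemma gradient_gap x y :
  f x + hinner (gradf x) (hsub y x)
    + / (2 * L) * hinner (hsub (gradf y) (gradf x)) (hsub (gradf y) (gradf x)) <= f y.
Proof.
  set (D := hsub (gradf y) (gradf x)).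
  pose proof (descent_lemma y (hscal (- / L) D)) as H1.
  pose proof (convex_gradient_ineq Hconv x (hadd y (hscal (- / L) D))) as H2.
  assert (E : hinner D D = hinner (gradf y) D - hinner (gradf x) D)
    by (unfold D at 1; apply hinner_sub_l).
  replace (/ (2 * L)) with (/ 2 * / L) by (field; lra).
  revert H1 H2. autorewrite with hinner. intros H1 H2.
  replace (L / 2 * (- / L * (- / L * hinner D D))) with (/ 2 * (/ L * hinner D D)) in H1
    by (field; lra).
  nra.
Qed.

(* Baillon-Haddad *)
Lemma gradient_cocoercive x y :
  hinner (hsub (gradf x) (gradf y)) (hsub (gradf x) (gradf y))
    <= L * hinner (hsub (gradf x) (gradf y)) (hsub x y).
Proof.
  pose proof (gradient_gap x y) as H1. pose proof (gradient_gap y x) as H2.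
  apply (Rmult_le_reg_l (/ L)); [now apply Rinv_0_lt_compat|].
  rewrite <- Rmult_assoc, Rinv_l, Rmult_1_l by lra.
  rewrite Rinv_mult in *. revert H1 H2. hexpand. lra.
Qed.
End Gradient.

(** * Stability of convexity and lower semicontinuity *)

Section ConvexLsc.
Context {H : Hilbert}.
Implicit Types (phi psi : H -> ereal).

Lemma convex_eadd phi psi : convex phi -> convex psi -> convex (fun z => eadd (phi z) (psi z)).
Proof.
  intros Hp Hq x y t Ht. specialize (Hp x y t Ht). specialize (Hq x y t Ht). cbv beta.
  destruct (phi x), (phi y), (psi x), (psi y), (phi (hadd _ _)), (psi (hadd _ _));
    simpl in *; try contradiction; trivial. nra.
Qed.

(** Otherwise a subsequence would stay in the sublevel set of level [a], which is closed. *)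
Lemma lsc_eventually phi (u : nat -> H) l a :
  lsc phi -> hconverges u l -> ~ ele (phi l) (Fin a) ->
  exists N, forall n, (N <= n)%nat -> ~ ele (phi (u n)) (Fin a).
Proof.
  intros Hl Hu Ha. apply NNPP. intros Hno. apply Ha.
  assert (Hs : forall N, exists n, (N <= n)%nat /\ ele (phi (u n)) (Fin a)).
  { intros N. apply NNPP. intros Hn. apply Hno. exists N. intros n HN Hle. apply Hn. eauto. }
  apply ClassicalEpsilon.choice in Hs. destruct Hs as [s Hs].
  apply (Hl a (fun n => u (s n))); [|apply Hs].
  apply hconverges_reindex; [apply Hs | exact Hu].
Qed.

Lemma lsc_eadd phi psi : lsc phi -> lsc psi -> lsc (fun z => eadd (phi z) (psi z)).
Proof.
  intros Hp Hq r u l Hu Hle. apply NNPP. intros Hno.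
  (* Split the level [r] so that both values at [l] strictly exceed their share; if one value is
     infinite, its share can be as large as needed. *)
  assert (Hab : exists a b, r <= a + b /\ ~ ele (phi l) (Fin a) /\ ~ ele (psi l) (Fin b)).
  { destruct (phi l) as [s|], (psi l) as [t|]; simpl in *.
    - exists (s - (s + t - r) / 2), (t - (s + t - r) / 2). lra.
    - exists (s - 1), (r - s + 1). lra.
    - exists (r - t + 1), (t - 1). lra.
    - exists r, 0. intuition lra. }
  destruct Hab as (a & b & Hr & Ha & Hb).
  destruct (lsc_eventually phi u l a Hp Hu Ha) as [N1 H1].
  destruct (lsc_eventually psi u l b Hq Hu Hb) as [N2 H2].
  specialize (H1 (N1 + N2)%nat ltac:(lia)). specialize (H2 (N1 + N2)%nat ltac:(lia)).
  specialize (Hle (N1 + N2)%nat).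
  destruct (phi (u _)), (psi (u _)); simpl in *; try contradiction. lra.
Qed.

Lemma convex_lin c : convex (fun z : H => Fin (hinner z c)).
Proof. intros x y t Ht. simpl. hexpand. lra. Qed.

Lemma lsc_lin c : lsc (fun z : H => Fin (hinner z c)).
Proof.
  intros r u l Hu Hle. simpl in *. apply le_of_le_add_eps. intros e He.
  destruct (Un_cv_eventually_le _ _ e (hconverges_hinner _ _ c Hu) He) as [N HN].
  specialize (HN N (le_n N)). specialize (Hle N). lra.
Qed.

(** The affine minorant that touches [f] at the limit point is continuous along the sequence. *)
Lemma lsc_minorant (f : H -> R) (gradf : H -> H) :
  (forall x z, f x + hinner (gradf x) (hsub z x) <= f z) -> lsc (fun z => Fin (f z)).
Proof.
  intros Hf r u l Hu Hle. simpl in *. apply le_of_le_add_eps. intros e He.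
  destruct (Un_cv_eventually_le _ _ e (hconverges_hinner _ _ (gradf l) Hu) He) as [N HN].
  specialize (HN N (le_n N)). specialize (Hle N). specialize (Hf l (u N)).
  revert Hf HN. hexpand. intros; lra.
Qed.
End ConvexLsc.

(** * Bounded linear maps *)

Section LinearMap.
Context {H G : Hilbert} (T : H -> G).

Lemma bounded_linear_sq :
  (forall x y, T (hadd x y) = hadd (T x) (T y)) -> (forall a x, T (hscal a x) = hscal a (T x)) ->
  forall c, (forall x, hinner (T x) (T x) <= c * hinner x x) ->
  bounded_linear T.
Proof.
  intros Ha Hs c Hc. split; [exact Ha | split; [exact Hs|]].
  (* A crude bound for the square root of [c], valid also for negative [c]. *)
  exists (Rmax c 0 + 1). intros x. specialize (Hc x). rewrite <- !hnorm_sq in Hc.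
  pose proof (hnorm_pos x). pose proof (hnorm_pos (T x)).
  pose proof (Rmax_l c 0). pose proof (Rmax_r c 0). set (M := Rmax c 0) in *.
  apply Rnot_lt_le. intros Hlt.
  assert (((M + 1) * hnorm x) ^ 2 < hnorm (T x) ^ 2)
    by (assert (0 <= (M + 1) * hnorm x) by nra; nra).
  assert (c * hnorm x ^ 2 <= M * hnorm x ^ 2) by (apply Rmult_le_compat_r; nra). nra.
Qed.

Context (HT : bounded_linear T).

Lemma bounded_linear_sub x y : T (hsub x y) = hsub (T x) (T y).
Proof.
  destruct HT as (Ha & Hs & _).
  replace (hsub x y) with (hadd x (hscal (-1) y)) by hvec.
  rewrite Ha, Hs. hvec.
Qed.

Lemma bounded_linear_sq_bound :
  exists c, 0 <= c /\ forall x, hinner (T x) (T x) <= c * hinner x x.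
Proof.
  destruct HT as (_ & _ & c & Hc). exists (c ^ 2). split; [nra|]. intros x.
  rewrite <- !hnorm_sq. specialize (Hc x). pose proof (hnorm_pos (T x)). nra.
Qed.

Lemma bounded_linear_converges u l : hconverges u l -> hconverges (fun n => T (u n)) (T l).
Proof.
  intros Hu. apply hconverges_sq. apply hconverges_sq in Hu.
  destruct bounded_linear_sq_bound as (c & _ & Hc).
  apply Un_cv_null_of_le with (b := fun n => c * hinner (hsub (u n) l) (hsub (u n) l)).
  - intros n. split; [apply hinner_pos|]. rewrite <- bounded_linear_sub. apply Hc.
  - rewrite <- (Rmult_0_r c). now apply Un_cv_scal.
Qed.

Lemma convex_comp phi : convex phi -> convex (fun x => phi (T x)).
Proof.
  intros Hc x y t Ht. destruct HT as (Ha & Hs & _). rewrite Ha, !Hs. now apply Hc.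
Qed.

Lemma lsc_comp phi : lsc phi -> lsc (fun x => phi (T x)).
Proof.
  intros Hl r u l Hu Hle. apply (Hl r (fun n => T (u n))); [|exact Hle].
  now apply bounded_linear_converges.
Qed.
End LinearMap.

(** * Closed convex hulls of tails, in place of weak compactness *)

Section TailPoints.
Context {H : Hilbert}.

Definition closed_convex (K : H -> Prop) : Prop :=
  (forall x y t, 0 < t < 1 -> K x -> K y -> K (hadd (hscal t x) (hscal (1 - t) y))) /\
  (forall u l, hconverges u l -> (forall n, K (u n)) -> K l).

(* The points of the intersection of the closed convex hulls of the tails of [u]. *)
Definition tail_point (u : nat -> H) (p : H) : Prop :=
  forall K, closed_convex K -> (exists n, forall k, (n <= k)%nat -> K (u k)) -> K p.

Lemma closed_convex_sublevel (phi : H -> ereal) r :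
  convex phi -> lsc phi -> closed_convex (fun z => ele (phi z) (Fin r)).
Proof.
  intros Hc Hl. split.
  - intros x y t Ht Hx Hy. replace r with (t * r + (1 - t) * r) by ring. now apply convex_le.
  - intros u l. apply Hl.
Qed.

(** The projection of the origin is the proximal point at 0 of the indicator function of [K]. *)
Lemma closed_convex_min_norm (K : H -> Prop) :
  closed_convex K -> (exists x, K x) ->
  exists p, K p /\ forall x, K x -> hinner p p <= hinner x x.
Proof.
  intros [Hcv Hcl] [x0 Hx0].
  set (phi := fun z : H => if excluded_middle_informative (K z) then Fin 0 else PInf).
  assert (HphiK : forall z, K z -> phi z = Fin 0).
  { intros z Hz. unfold phi. destruct (excluded_middle_informative _); tauto. }
  assert (HphiN : forall z, ~ K z -> phi z = PInf).
  { intros z Hz. unfold phi. destruct (excluded_middle_informative _); tauto. }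
  assert (Hcp : convex phi).
  { intros x y t Ht. destruct (classic (K x)) as [Hx|Hx], (classic (K y)) as [Hy|Hy];
      try (rewrite (HphiN x Hx)); try (rewrite (HphiN y Hy)); simpl;
      try (destruct (phi (hadd _ _)), (phi x); exact I).
    rewrite !HphiK by auto. simpl. lra. }
  assert (Hlp : lsc phi).
  { intros r u l Hu Hle.
    assert (HK : forall n, K (u n)).
    { intros n. apply NNPP. intros Hn. specialize (Hle n). now rewrite HphiN in Hle. }
    rewrite HphiK by (now apply (Hcl u)). specialize (Hle 0%nat). now rewrite HphiK in Hle. }
  destruct (is_prox_exists phi) with (lam := 1) (u := @hzero H) as [p Hp]; auto.
  - exists x0. rewrite HphiK; congruence.
  - lra.
  - exists 0, hzero. intros z. rewrite hinner_0_l. unfold phi.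
    destruct (excluded_middle_informative _); simpl; [lra | trivial].
  - assert (HpK : K p).
    { apply NNPP. intros Hn. specialize (Hp x0). rewrite HphiN, HphiK in Hp by auto. exact Hp. }
    exists p. split; [exact HpK|]. intros x Hx. specialize (Hp x).
    rewrite !HphiK, !hnorm_sq in Hp by auto. revert Hp. simpl. hexpand. lra.
Qed.

Lemma bounded_growing_cauchy (a : nat -> R) M :
  (forall n, a n <= a (S n)) -> (forall n, a n <= M) ->
  forall e, 0 < e -> exists N, forall n m, (N <= n)%nat -> (N <= m)%nat -> Rabs (a n - a m) < e.
Proof.
  intros Hi HM e He. destruct (growing_cv a) as [l Hl].
  - exact Hi.
  - exists M. intros r [n ->]. apply HM.
  - destruct (Un_cv_eventually_le a l (e / 3) Hl) as [N HN]; [lra|].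
    exists N. intros n m Hn Hm. pose proof (HN n Hn). pose proof (HN m Hm).
    apply Rabs_def1; lra.
Qed.

(** The hulls shrink, so the norms of their minimal elements [p n] increase, and they stay bounded.
    For [n <= m] the midpoint of [p n] and [p m] is still in [hull n], so the parallelogram law
    makes [p] Cauchy; its limit lies in every hull. *)
Lemma tail_point_exists (u : nat -> H) M :
  (forall k, hinner (u k) (u k) <= M) -> exists p, tail_point u p.
Proof.
  intros HM.
  set (hull := fun n p => forall K, closed_convex K ->
    (forall k, (n <= k)%nat -> K (u k)) -> K p).
  assert (Hhull : forall n, closed_convex (hull n)).
  { intros n. split.
    - intros x y t Ht Hx Hy K HK HKn. apply HK; [exact Ht | |]; auto.
      + now apply Hx. + now apply Hy.
    - intros v l Hv Hvn K HK HKn. destruct HK as [H1 H2]. apply (H2 v); [exact Hv|].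
      intros k. apply Hvn; [split; assumption | exact HKn]. }
  assert (Hu : forall n, hull n (u n)) by (intros n K _ HK; apply HK; lia).
  assert (Hmono : forall n m p, (n <= m)%nat -> hull m p -> hull n p).
  { intros n m p Hnm Hp K HK HKn. apply Hp; [exact HK|]. intros k Hk. apply HKn. lia. }
  assert (Hmin : forall n, exists p, hull n p /\ forall x, hull n x -> hinner p p <= hinner x x).
  { intros n. apply closed_convex_min_norm; eauto. }
  apply ClassicalEpsilon.choice in Hmin. destruct Hmin as [p Hp].
  assert (Hpar : forall n m, (n <= m)%nat ->
    hinner (hsub (p n) (p m)) (hsub (p n) (p m))
      <= 2 * (hinner (p m) (p m) - hinner (p n) (p n))).
  { intros n m Hnm. destruct (Hp n) as [Hn Hmn], (Hp m) as [Hm _].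
    assert (Hh : hull n (hadd (hscal (/ 2) (p n)) (hscal (1 - / 2) (p m)))).
    { apply (Hhull n); [lra | exact Hn | eauto]. }
    apply Hmn in Hh. revert Hh. hexpand. lra. }
  destruct (cauchy_converges p) as [l Hl].
  { intros e He.
    destruct (bounded_growing_cauchy (fun n => hinner (p n) (p n)) M) with (e := e / 2) as [N HN].
    - intros n. apply (Hp n), (Hmono n (S n)); [lia | apply Hp].
    - intros n. eapply Rle_trans; [apply (Hp n), Hu | apply HM].
    - lra.
    - exists N. intros n m Hn Hm. destruct (Nat.le_ge_cases n m) as [E|E].
      + specialize (Hpar n m E). specialize (HN m n Hm Hn). apply Rabs_def2 in HN. lra.
      + specialize (Hpar m n E). specialize (HN n m Hn Hm). apply Rabs_def2 in HN.
        revert Hpar. hexpand. lra. }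
  exists l. intros K HK [n Hn].
  assert (Hln : hull n l).
  { apply (proj2 (Hhull n) (fun k => p (n + k)%nat)).
    - now apply hconverges_shift.
    - intros k. apply (Hmono n (n + k)%nat); [lia | apply Hp]. }
  now apply Hln.
Qed.

Lemma tail_point_le (u : nat -> H) p c r :
  tail_point u p -> (exists n, forall k, (n <= k)%nat -> hinner (u k) c <= r) -> hinner p c <= r.
Proof.
  intros Hp Hu.
  exact (Hp _ (closed_convex_sublevel _ r (convex_lin c) (lsc_lin c)) Hu).
Qed.

Lemma tail_point_inner (u : nat -> H) p c l :
  tail_point u p -> Un_cv (fun k => hinner (u k) c) l -> hinner p c = l.
Proof.
  intros Hp Hu. apply Rle_antisym; apply le_of_le_add_eps; intros e He;
    destruct (Un_cv_eventually_le _ _ _ Hu He) as [N HN].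
  - apply (tail_point_le u); [exact Hp|]. exists N. intros k Hk. specialize (HN k Hk). lra.
  - assert (hinner p (hopp c) <= - (l - e)); [|rewrite hinner_opp_r in H0; lra].
    apply (tail_point_le u); [exact Hp|]. exists N. intros k Hk. rewrite hinner_opp_r.
    specialize (HN k Hk). lra.
Qed.

(* Tail points of a subsequence are tail points of the sequence, so uniqueness
   forbids a subsequence that stays away from [p] in some direction. *)
Lemma unique_tail_point_weak_cv (u : nat -> H) M :
  (forall k, hinner (u k) (u k) <= M) ->
  (forall p q, tail_point u p -> tail_point u q -> p = q) ->
  exists p, tail_point u p /\ weak_cv u p.
Proof.
  intros HM Huniq. destruct (tail_point_exists u M HM) as [p Hp].
  exists p. split; [exact Hp|].
  (* An upper bound suffices: applied to [hopp z] it becomes the lower one. *)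
  assert (Hside : forall z e, 0 < e ->
    exists N, forall n, (N <= n)%nat -> hinner (u n) z < hinner p z + e).
  { intros z e He. apply NNPP. intros Hno.
    assert (Hs : forall N, exists n, (N <= n)%nat /\ hinner p z + e <= hinner (u n) z).
    { intros N. apply NNPP. intros Hn. apply Hno. exists N. intros n Hle.
      apply Rnot_le_lt. intros Hlt. apply Hn. eauto. }
    apply ClassicalEpsilon.choice in Hs. destruct Hs as [s Hs].
    destruct (tail_point_exists (fun n => u (s n)) M) as [q Hq]; [intros; apply HM|].
    assert (E : p = q).
    { apply Huniq; [exact Hp|]. intros K HK [n Hn]. apply Hq; [exact HK|].
      exists n. intros k Hk. apply Hn. destruct (Hs k). lia. }
    subst q. assert (hinner p (hopp z) <= - (hinner p z + e)).
    { apply (tail_point_le (fun n => u (s n))); [exact Hq|]. exists 0%nat. intros k _.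
      rewrite hinner_opp_r. destruct (Hs k). lra. }
    rewrite hinner_opp_r in *. lra. }
  intros z e He. destruct (Hside z e He) as [N1 H1]. destruct (Hside (hopp z) e He) as [N2 H2].
  exists (N1 + N2)%nat. intros n Hn.
  specialize (H1 n ltac:(lia)). specialize (H2 n ltac:(lia)).
  rewrite !hinner_opp_r in H2. unfold Rdist. apply Rabs_def1; lra.
Qed.
End TailPoints.

(** * Products of two Hilbert spaces *)

Section Product.
Context (X Y : Hilbert).

(** Written with the componentwise operations, since it becomes the [hcomplete] field of a space
    that does not exist yet. *)
Lemma hprod_complete (u : nat -> X * Y) :
  (forall eps, 0 < eps -> exists N, forall p q, (N <= p)%nat -> (N <= q)%nat ->
     sqrt (hinner (hadd (fst (u p)) (hopp (fst (u q)))) (hadd (fst (u p)) (hopp (fst (u q))))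
         + hinner (hadd (snd (u p)) (hopp (snd (u q)))) (hadd (snd (u p)) (hopp (snd (u q)))))
       < eps) ->
  exists l : X * Y, forall eps, 0 < eps -> exists N, forall n, (N <= n)%nat ->
     sqrt (hinner (hadd (fst (u n)) (hopp (fst l))) (hadd (fst (u n)) (hopp (fst l)))
         + hinner (hadd (snd (u n)) (hopp (snd l))) (hadd (snd (u n)) (hopp (snd l)))) < eps.
Proof.
  intros Hu.
  destruct (hcomplete X (fun n => fst (u n))) as [l1 H1].
  { intros e He. destruct (Hu e He) as [N HN]. exists N. intros p q Hp Hq.
    eapply Rle_lt_trans; [|apply (HN p q Hp Hq)]. apply sqrt_le_1_alt.
    pose proof (hinner_pos Y (hadd (snd (u p)) (hopp (snd (u q))))). lra. }
  destruct (hcomplete Y (fun n => snd (u n))) as [l2 H2].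
  { intros e He. destruct (Hu e He) as [N HN]. exists N. intros p q Hp Hq.
    eapply Rle_lt_trans; [|apply (HN p q Hp Hq)]. apply sqrt_le_1_alt.
    pose proof (hinner_pos X (hadd (fst (u p)) (hopp (fst (u q))))). lra. }
  exists (l1, l2). intros e He.
  destruct (H1 (e / 2)) as [N1 HN1]; [lra|]. destruct (H2 (e / 2)) as [N2 HN2]; [lra|].
  exists (N1 + N2)%nat. intros n Hn.
  specialize (HN1 n ltac:(lia)). specialize (HN2 n ltac:(lia)). simpl.
  set (a := hinner _ _) in HN1. set (b := hinner _ _) in HN2.
  fold a b. assert (0 <= a) by apply hinner_pos. assert (0 <= b) by apply hinner_pos.
  pose proof (sqrt_sqrt a H). pose proof (sqrt_sqrt b H0).
  pose proof (sqrt_pos a). pose proof (sqrt_pos b).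
  rewrite <- (sqrt_Rsqr e) by lra. apply sqrt_lt_1_alt. unfold Rsqr. nra.
Qed.

(** Transparent, so that [simpl] computes inner products and projections componentwise. *)
Definition hprod : Hilbert.
Proof.
  refine {| hT := (X * Y)%type;
    hzero := (hzero, hzero);
    hadd := fun a b => (hadd (fst a) (fst b), hadd (snd a) (snd b));
    hopp := fun a => (hopp (fst a), hopp (snd a));
    hscal := fun t a => (hscal t (fst a), hscal t (snd a));
    hinner := fun a b => hinner (fst a) (fst b) + hinner (snd a) (snd b);
    hcomplete := hprod_complete |}; simpl.
  - intros; f_equal; apply hadd_assoc.
  - intros; f_equal; apply hadd_comm.
  - intros [a b]; simpl; f_equal; apply hadd_0.
  - intros; f_equal; apply hadd_opp.
  - intros; f_equal; apply hscal_assoc.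
  - intros [a b]; simpl; f_equal; apply hscal_1.
  - intros; f_equal; apply hscal_distr_v.
  - intros; f_equal; apply hscal_distr_s.
  - intros; f_equal; apply hinner_sym.
  - intros; rewrite !hinner_add; ring.
  - intros; rewrite !hinner_scal; ring.
  - intros; apply Rplus_le_le_0_compat; apply hinner_pos.
  - intros [a b] E; simpl in *.
    pose proof (hinner_pos X a). pose proof (hinner_pos Y b).
    f_equal; apply hinner_def; lra.
Defined.

Lemma bounded_linear_fst : bounded_linear (fst : hprod -> X).
Proof.
  apply (bounded_linear_sq (H := hprod) (fst : hprod -> X)) with (c := 1); auto.
  intros z. simpl. pose proof (hinner_pos Y (snd z)). lra.
Qed.

Lemma bounded_linear_snd : bounded_linear (snd : hprod -> Y).
Proof.
  apply (bounded_linear_sq (H := hprod) (snd : hprod -> Y)) with (c := 1); auto.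
  intros z. simpl. pose proof (hinner_pos X (fst z)). lra.
Qed.
End Product.

(** * Bounded sequences and null sequences of vectors *)

Section BoundedNull.
Context {H : Hilbert}.
Implicit Types u w : nat -> H.

Definition hbounded u := exists M, forall k, hinner (u k) (u k) <= M.
Definition hnull u := Un_cv (fun k => hinner (u k) (u k)) 0.

Lemma hinner_add_sq_le (a b : H) :
  hinner (hadd a b) (hadd a b) <= 2 * hinner a a + 2 * hinner b b.
Proof. pose proof (hinner_pos H (hsub a b)) as P. revert P. hexpand. lra. Qed.

Lemma hbounded_add u w : hbounded u -> hbounded w -> hbounded (fun k => hadd (u k) (w k)).
Proof.
  intros [M HM] [M' HM']. exists (2 * M + 2 * M'). intros k.
  pose proof (hinner_add_sq_le (u k) (w k)). specialize (HM k). specialize (HM' k). lra.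
Qed.

Lemma hbounded_scal c u : hbounded u -> hbounded (fun k => hscal c (u k)).
Proof.
  intros [M HM]. exists (c ^ 2 * M). intros k. hexpand. specialize (HM k).
  assert (c ^ 2 * hinner (u k) (u k) <= c ^ 2 * M) by (apply Rmult_le_compat_l; nra). lra.
Qed.

Lemma hbounded_const (a : H) : hbounded (fun _ => a).
Proof. exists (hinner a a). intros; lra. Qed.

Lemma hbounded_sub u w : hbounded u -> hbounded w -> hbounded (fun k => hsub (u k) (w k)).
Proof.
  intros Hu Hw. destruct (hbounded_add _ _ Hu (hbounded_scal (-1) _ Hw)) as [M HM].
  exists M. intros k. specialize (HM k).
  now replace (hsub (u k) (w k)) with (hadd (u k) (hscal (-1) (w k))) by hvec.
Qed.

Lemma hbounded_shift u : hbounded u -> hbounded (fun k => u (S k)).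
Proof. intros [M HM]. exists M. intros; apply HM. Qed.

Lemma hbounded_linear {G : Hilbert} (T : H -> G) u :
  bounded_linear T -> hbounded u -> exists M, forall k, hinner (T (u k)) (T (u k)) <= M.
Proof.
  intros HT [M HM]. destruct (bounded_linear_sq_bound T HT) as (c & Hc0 & Hc).
  exists (c * M). intros k. eapply Rle_trans; [apply Hc|]. now apply Rmult_le_compat_l.
Qed.

Lemma hnull_of_le {G : Hilbert} (w : nat -> G) u c :
  hnull u -> (forall k, hinner (w k) (w k) <= c * hinner (u k) (u k)) ->
  Un_cv (fun k => hinner (w k) (w k)) 0.
Proof.
  intros Hu Hc. apply Un_cv_null_of_le with (b := fun k => c * hinner (u k) (u k)).
  - intros k. split; [apply hinner_pos | apply Hc].
  - rewrite <- (Rmult_0_r c). now apply Un_cv_scal.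
Qed.
End BoundedNull.

Lemma ele_PInf u : ele u PInf.
Proof. destruct u; exact I. Qed.

(** * Weak convergence of the Condat-Vu iteration *)

Section CondatVu.
Context (X G : Hilbert) (f : X -> R) (gradf : X -> X) (g : X -> ereal) (h : G -> ereal)
  (B : X -> G) (Bs : G -> X) (L N al be : R).
Context (HL : 0 < L) (Hfconv : convex_real f) (Hgrad : is_gradient f gradf)
  (Hlip : forall u v, hnorm (hsub (gradf u) (gradf v)) <= L * hnorm (hsub u v))
  (Hgc : convex g) (Hgl : lsc g) (Hhc : convex h) (Hhl : lsc h)
  (HB : bounded_linear B) (HBs : is_adjoint B Bs)
  (HN : forall z, hinner (B z) (B z) <= N * hinner z z)
  (HN0 : 0 <= N) (Hal : L / 2 < al) (Hbe : 0 < be) (Hstep : N < (al - L / 2) * be).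

(** The Karush-Kuhn-Tucker conditions, with the dual inclusion inverted so that it involves [h] and
    not its conjugate. *)
Definition saddle (xs : X) (vs : G) : Prop :=
  subdiff g xs (hsub (hopp (Bs vs)) (gradf xs)) /\ subdiff h (B xs) vs.

Definition cv_form (a : X) (b : G) : R :=
  al * hinner a a - 2 * hinner (B a) b + be * hinner b b.

Lemma cv_form_coercive : exists c, 0 < c /\ forall a b,
  c * (hinner a a + hinner b b) <= cv_form a b - L / 2 * hinner a a.
Proof.
  set (A := al - L / 2) in *. assert (HA : 0 < A) by (unfold A; lra).
  (* Young's inequality with weight [th] on the cross term leaves the coefficients [A - N / th] and
     [be - th]. Both are positive when [N / A < th < be], so the midpoint is taken; [Hstep] makes
     the interval nonempty. *)
  set (th := (N / A + be) / 2).
  assert (HNA : N / A < be).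
  { apply (Rmult_lt_reg_r A); [exact HA|]. unfold Rdiv. rewrite Rmult_assoc, Rinv_l by lra. lra. }
  assert (HNA0 : 0 <= N / A) by (apply Rmult_le_pos; [lra | now apply Rlt_le, Rinv_0_lt_compat]).
  assert (Hth : 0 < th) by (unfold th; lra).
  assert (HNth : / th * N < A).
  { apply (Rmult_lt_reg_l th); [exact Hth|]. rewrite <- Rmult_assoc, Rinv_r, Rmult_1_l by lra.
    assert (N / A < th) by (unfold th; lra).
    apply (Rmult_lt_compat_r A) in H; [|exact HA].
    unfold Rdiv in H. rewrite Rmult_assoc, Rinv_l in H by lra. lra. }
  exists (Rmin (A - / th * N) (be - th)). split.
  - apply Rmin_glb_lt; [lra | unfold th; lra].
  - intros a b. unfold cv_form. pose proof (hinner_young b (B a) th Hth) as Y.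
    rewrite (hinner_sym G b (B a)) in Y.
    assert (/ th * hinner (B a) (B a) <= / th * (N * hinner a a))
      by (apply Rmult_le_compat_l; [now apply Rlt_le, Rinv_0_lt_compat | apply HN]).
    pose proof (hinner_pos X a). pose proof (hinner_pos G b).
    set (m := Rmin _ _).
    assert (m <= A - / th * N) by apply Rmin_l. assert (m <= be - th) by apply Rmin_r.
    assert (m * hinner a a <= (A - / th * N) * hinner a a) by (apply Rmult_le_compat_r; lra).
    assert (m * hinner b b <= (be - th) * hinner b b) by (apply Rmult_le_compat_r; lra).
    unfold A in *. nra.
Qed.

(** Write [c - b] as [(a - b) - (a - c)]: cocoercivity bounds the first pairing below by
    [|D|^2 / L], and completing the square in [D] handles the second. *)
Lemma gradient_three_point a b c :
  - (L / 4) * hinner (hsub a c) (hsub a c) <= hinner (hsub (gradf a) (gradf b)) (hsub c b).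
Proof.
  pose proof (gradient_cocoercive f gradf Hgrad L HL Hlip Hfconv a b) as C.
  set (D := hsub (gradf a) (gradf b)) in *.
  pose proof (hinner_pos X (hsub D (hscal (L / 2) (hsub a c)))) as P.
  apply (Rmult_le_reg_l L); [exact HL|].
  revert C P. hexpand. lra.
Qed.

Lemma subdiff_monotone {Y : Hilbert} (phi : Y -> ereal) a b u w :
  subdiff phi a u -> subdiff phi b w -> 0 <= hinner (hsub u w) (hsub a b).
Proof.
  intros (r & Er & Hr) (s & Es & Hs). specialize (Hr b). specialize (Hs a).
  rewrite Es in Hr. rewrite Er in Hs. simpl in *. revert Hr Hs. hexpand. lra.
Qed.

Context (x : nat -> X) (v : nat -> G).
Let q k := hadd (hscal be (hsub (v k) (v (S k)))) (B (hsub (hscal 2 (x (S k))) (x k))).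
Context (Hx : forall k, subdiff g (x (S k))
   (hsub (hsub (hscal al (hsub (x k) (x (S k)))) (Bs (v k))) (gradf (x k))))
  (Hv : forall k, subdiff h (q k) (v (S k))).

Lemma B_scal c a : B (hscal c a) = hscal c (B a).
Proof. apply HB. Qed.

Lemma adjoint_l a b : hinner (Bs a) b = hinner (B b) a.
Proof. now rewrite HBs, hinner_sym. Qed.

(** Brings every pairing that involves the adjoint to the form [hinner (B a) b], so that [lra] can
    match them. *)
Ltac Bexpand := rewrite ?(bounded_linear_sub B HB), ?B_scal; hexpand;
  rewrite ?adjoint_l, <- ?HBs; hexpand.

(** Add the monotonicity inequalities of both subdifferentials. The extrapolation [2 x+ - x] makes
    the cross terms symmetric, so the sum is a pairing in the metric of [cv_form], and polarization
    gives its three squares. The gradient term costs [L / 4], doubled by the polarization. *)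
Lemma fejer_step xs vs k : saddle xs vs ->
  cv_form (hsub (x (S k)) xs) (hsub (v (S k)) vs)
    + (cv_form (hsub (x k) (x (S k))) (hsub (v k) (v (S k)))
       - L / 2 * hinner (hsub (x k) (x (S k))) (hsub (x k) (x (S k))))
  <= cv_form (hsub (x k) xs) (hsub (v k) vs).
Proof.
  intros [Sg Sh].
  pose proof (subdiff_monotone g _ _ _ _ (Hx k) Sg) as M1.
  pose proof (subdiff_monotone h _ _ _ _ (Hv k) Sh) as M2.
  pose proof (gradient_three_point (x k) xs (x (S k))) as M3.
  unfold q, cv_form in *. revert M1 M2 M3. Bexpand. lra.
Qed.

Lemma fejer_cv xs vs : saddle xs vs ->
  exists l, Un_cv (fun k => cv_form (hsub (x k) xs) (hsub (v k) vs)) l.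
Proof.
  intros Hs. destruct cv_form_coercive as (c & Hc & Hco).
  assert (Hpos : forall a b, 0 <= cv_form a b - L / 2 * hinner a a).
  { intros a b. eapply Rle_trans; [|apply Hco]. pose proof (hinner_pos X a).
    pose proof (hinner_pos G b). apply Rmult_le_pos; lra. }
  destruct (decreasing_cv (fun k => cv_form (hsub (x k) xs) (hsub (v k) vs))) as [l Hl].
  - intros k. pose proof (fejer_step xs vs k Hs).
    pose proof (Hpos (hsub (x k) (x (S k))) (hsub (v k) (v (S k)))). lra.
  - exists 0. intros r [k ->]. unfold opp_seq.
    pose proof (Hpos (hsub (x k) xs) (hsub (v k) vs)).
    pose proof (hinner_pos X (hsub (x k) xs)).
    assert (0 <= L / 2 * hinner (hsub (x k) xs) (hsub (x k) xs)) by (apply Rmult_le_pos; lra). lra.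
  - exists l. exact Hl.
Qed.

Context (Hsaddle : exists xs vs, saddle xs vs).

(** The decrease of the convergent sequence [cv_form] dominates a multiple of the squared steps. *)
Lemma steps_null :
  hnull (fun k => hsub (x k) (x (S k))) /\ hnull (fun k => hsub (v k) (v (S k))).
Proof.
  destruct Hsaddle as (xs & vs & Hs). destruct (fejer_cv xs vs Hs) as [l Hl].
  destruct cv_form_coercive as (c & Hc & Hco).
  pose proof (CV_minus _ _ _ _ Hl (Un_cv_shift _ _ Hl)) as Hd. rewrite Rminus_diag in Hd.
  apply (Un_cv_scal (/ c)) in Hd. rewrite Rmult_0_r in Hd.
  assert (Hle : forall k, hinner (hsub (x k) (x (S k))) (hsub (x k) (x (S k)))
      + hinner (hsub (v k) (v (S k))) (hsub (v k) (v (S k)))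
     <= / c * (cv_form (hsub (x k) xs) (hsub (v k) vs)
             - cv_form (hsub (x (S k)) xs) (hsub (v (S k)) vs))).
  { intros k. pose proof (fejer_step xs vs k Hs).
    specialize (Hco (hsub (x k) (x (S k))) (hsub (v k) (v (S k)))).
    apply (Rmult_le_reg_l c); [exact Hc|]. rewrite <- Rmult_assoc, Rinv_r, Rmult_1_l by lra. lra. }
  split; (eapply Un_cv_null_of_le; [|exact Hd]); intros k; specialize (Hle k); cbv beta;
    pose proof (hinner_pos X (hsub (x k) (x (S k))));
    pose proof (hinner_pos G (hsub (v k) (v (S k)))); lra.
Qed.

Lemma iterates_bounded : hbounded x /\ hbounded v.
Proof.
  destruct Hsaddle as (xs & vs & Hs). destruct cv_form_coercive as (c & Hc & Hco).
  set (W := fun k => cv_form (hsub (x k) xs) (hsub (v k) vs)).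
  assert (HW : forall k, W k <= W 0%nat).
  { induction k as [|k IH]; [lra|]. eapply Rle_trans; [|exact IH].
    pose proof (fejer_step xs vs k Hs). fold (W k) (W (S k)) in H.
    specialize (Hco (hsub (x k) (x (S k))) (hsub (v k) (v (S k)))).
    pose proof (hinner_pos X (hsub (x k) (x (S k)))).
    pose proof (hinner_pos G (hsub (v k) (v (S k)))). nra. }
  assert (Hle : forall k, hinner (hsub (x k) xs) (hsub (x k) xs)
     + hinner (hsub (v k) vs) (hsub (v k) vs) <= / c * W 0%nat).
  { intros k. specialize (Hco (hsub (x k) xs) (hsub (v k) vs)). specialize (HW k).
    unfold W at 1 in HW. pose proof (hinner_pos X (hsub (x k) xs)).
    assert (0 <= L / 2 * hinner (hsub (x k) xs) (hsub (x k) xs)) by (apply Rmult_le_pos; lra).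
    apply (Rmult_le_reg_l c); [exact Hc|]. rewrite <- Rmult_assoc, Rinv_r, Rmult_1_l by lra. lra. }
  split.
  - destruct (hbounded_add (fun k => hsub (x k) xs) (fun _ => xs)) as [M HM].
    + exists (/ c * W 0%nat). intros k. specialize (Hle k).
      pose proof (hinner_pos G (hsub (v k) vs)). lra.
    + apply hbounded_const.
    + exists M. intros k. specialize (HM k).
      now replace (hadd (hsub (x k) xs) xs) with (x k) in HM by hvec.
  - destruct (hbounded_add (fun k => hsub (v k) vs) (fun _ => vs)) as [M HM].
    + exists (/ c * W 0%nat). intros k. specialize (Hle k).
      pose proof (hinner_pos X (hsub (x k) xs)). lra.
    + apply hbounded_const.
    + exists M. intros k. specialize (HM k).
      now replace (hadd (hsub (v k) vs) vs) with (v k) in HM by hvec.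
Qed.

(** The right side tends to 0 by [steps_null]: asymptotically [q k] is [B (x (S k))]. *)
Lemma q_gap k : hsub (q k) (B (x (S k))) =
  hsub (hscal be (hsub (v k) (v (S k)))) (B (hsub (x k) (x (S k)))).
Proof. unfold q. rewrite !(bounded_linear_sub B HB), !B_scal. hvec. Qed.

Lemma q_bounded : hbounded q.
Proof.
  destruct iterates_bounded as [Hbx Hbv]. apply hbounded_add.
  - apply hbounded_scal, hbounded_sub; [exact Hbv | now apply hbounded_shift].
  - apply (hbounded_linear B (fun k => hsub (hscal 2 (x (S k))) (x k)) HB).
    apply hbounded_sub; [|exact Hbx]. now apply hbounded_scal, hbounded_shift.
Qed.

Let Z : Hilbert := hprod X (hprod G G).
(** Groups the points at which the inclusions of step [k] hold; hence [S k] beside [q k]. *)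
Let zeta (k : nat) : Z := (x (S k), (v (S k), q k)).

Lemma zeta_bounded : exists M, forall k, hinner (zeta k) (zeta k) <= M.
Proof.
  destruct iterates_bounded as [[M1 H1] [M2 H2]]. destruct q_bounded as [M3 H3].
  exists (M1 + (M2 + M3)). intros k. simpl.
  specialize (H1 (S k)). specialize (H2 (S k)). specialize (H3 k). lra.
Qed.

Lemma Un_cv_lin2 a b (s t : nat -> R) :
  Un_cv s 0 -> Un_cv t 0 -> Un_cv (fun k => a * s k + b * t k) 0.
Proof.
  intros Hs Ht. replace 0 with (a * 0 + b * 0) by ring.
  apply CV_plus; now apply Un_cv_scal.
Qed.

(** The linear functional given by [(- Bs w, 0, w)] maps [zeta k] to [<q k - B (x (S k)), w>], which
    is null. *)
Lemma tail_point_primal_dual p :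
  tail_point zeta p -> snd (snd p) = B (fst p).
Proof.
  intros Hp. apply hinner_ext. intros w.
  destruct steps_null as [Nx Nv].
  pose proof (tail_point_inner zeta p (hopp (Bs w), (hzero, w)) 0 Hp) as E.
  simpl in E. rewrite hinner_0_r, hinner_opp_r, <- HBs in E.
  assert (- hinner (B (fst p)) w + (0 + hinner (snd (snd p)) w) = 0); [|lra].
  apply E. clear E.
  assert (T1 : Un_cv (fun k => hinner w (hsub (v k) (v (S k)))) 0).
  { apply Un_cv_hinner_null with (M := hinner w w); [intros; lra | exact Nv]. }
  assert (T2 : Un_cv (fun k => hinner (Bs w) (hsub (x k) (x (S k)))) 0).
  { apply Un_cv_hinner_null with (M := hinner (Bs w) (Bs w)); [intros; lra | exact Nx]. }
  generalize (Un_cv_lin2 be (-1) _ _ T1 T2). apply Un_cv_ext. intros k.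
  pose proof (f_equal (fun z => hinner z w) (q_gap k)) as E. cbv beta in E.
  revert E. generalize (q k). intros qk. Bexpand. intros E. lra.
Qed.

(** One inequality holding both inclusions: [w = B (fst p)] isolates the primal one, [u = fst p] the
    dual one, and [w = B u] gives minimality. At step [k] the coupling of [v] with [q - B x+] is a
    null error, so what remains is convex in the triple and passes to tail points. *)
Lemma tail_point_vi p u w a b :
  tail_point zeta p -> g u = Fin a -> h w = Fin b ->
  exists a' b', g (fst p) = Fin a' /\ h (B (fst p)) = Fin b' /\
    f (fst p) + a' + b' + hinner (fst (snd p)) (hsub w (B u)) <= f u + a + b.
Proof.
  intros Hp Ea Eb. destruct steps_null as [Nx Nv]. destruct iterates_bounded as [Bx Bv].
  set (c := (hzero, (hsub w (B u), hzero)) : Z).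
  (* [h] is taken at the third component, since the iteration controls its value at [q k] and not at
     [B (x (S k))]. *)
  set (Psi := fun z : Z => eadd (Fin (f (fst z))) (eadd (g (fst z))
     (eadd (h (snd (snd z))) (Fin (hinner z c))))).
  pose proof (bounded_linear_fst X (hprod G G)) as L1.
  pose proof (bounded_linear_snd X (hprod G G)) as L2.
  pose proof (bounded_linear_snd G G) as L3.
  assert (Cf : convex (fun z => Fin (f z))) by (intros y z t Ht; apply Hfconv; exact Ht).
  assert (Lf : lsc (fun z => Fin (f z))).
  { apply (lsc_minorant f gradf). intros. now apply convex_gradient_ineq. }
  assert (PC : convex Psi).
  { unfold Psi.
    refine (convex_eadd _ _ (convex_comp (H := Z) _ L1 _ Cf) _).
    refine (convex_eadd _ _ (convex_comp (H := Z) _ L1 _ Hgc) _).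
    exact (convex_eadd _ _ (convex_comp (H := Z) _ L2 _ (convex_comp _ L3 _ Hhc)) (convex_lin c)). }
  assert (PL : lsc Psi).
  { unfold Psi.
    refine (lsc_eadd _ _ (lsc_comp (H := Z) _ L1 _ Lf) _).
    refine (lsc_eadd _ _ (lsc_comp (H := Z) _ L1 _ Hgl) _).
    exact (lsc_eadd _ _ (lsc_comp (H := Z) _ L2 _ (lsc_comp _ L3 _ Hhl)) (lsc_lin c)). }
  (* All the terms that contain a step difference, each pairing a bounded sequence with a null one;
     the nesting and the factors [1] fit [Un_cv_lin2]. *)
  set (e := fun k =>
     (al * hinner (hsub u (x (S k))) (hsub (x k) (x (S k)))
      + 1 * hinner (hsub u (x (S k))) (hsub (gradf (x (S k))) (gradf (x k))))
     + (-1 * hinner (B (hsub u (x (S k)))) (hsub (v k) (v (S k)))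
        + 1 * (- be * hinner (v (S k)) (hsub (v k) (v (S k)))
           + 1 * hinner (v (S k)) (B (hsub (x k) (x (S k))))))).
  assert (He : Un_cv e 0).
  { assert (Bu : hbounded (fun k => hsub u (x (S k)))).
    { apply hbounded_sub; [apply hbounded_const | now apply hbounded_shift]. }
    destruct (hbounded_linear B _ HB Bu) as [MB HMB]. destruct Bu as [Mu HMu].
    destruct (hbounded_shift _ Bv) as [Mv HMv].
    replace 0 with (0 + 0) by ring. apply CV_plus; repeat apply Un_cv_lin2;
      eapply Un_cv_hinner_null; try eassumption.
    - apply (hnull_of_le _ _ (L ^ 2) Nx). intros k. rewrite <- !hnorm_sq.
      replace (hnorm (hsub (x k) (x (S k)))) with (hnorm (hsub (x (S k)) (x k))).
      + pose proof (Hlip (x (S k)) (x k)).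
        pose proof (hnorm_pos (hsub (gradf (x (S k))) (gradf (x k)))). nra.
      + unfold hnorm. f_equal. hexpand. ring.
    - apply (hnull_of_le _ _ N Nx). intros k. apply HN. }
  assert (Hbound : forall k, ele (Psi (zeta k)) (Fin (f u + a + b - e k))).
  { intros k. destruct (Hx k) as (ak & Eak & Hak). destruct (Hv k) as (bk & Ebk & Hbk).
    specialize (Hak u). specialize (Hbk w). rewrite Ea in Hak. rewrite Eb in Hbk.
    pose proof (convex_gradient_ineq f gradf Hgrad Hfconv (x (S k)) u) as Hf.
    unfold Psi. simpl. rewrite Eak, Ebk. simpl in *.
    pose proof (f_equal (fun z => hinner z (v (S k))) (q_gap k)) as Q. cbv beta in Q.
    unfold e. clear Ebk. revert Hak Hbk Hf Q. generalize (q k). intros qk.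
    Bexpand. lra. }
  assert (HPsi : ele (Psi p) (Fin (f u + a + b))).
  { destruct (Psi p) as [r|] eqn:EP; simpl.
    - apply le_of_le_add_eps. intros e' He'. change (ele (Fin r) (Fin (f u + a + b + e'))).
      rewrite <- EP. apply (Hp _ (closed_convex_sublevel Psi _ PC PL)).
      destruct (Un_cv_eventually_le _ _ e' He He') as [n Hn]. exists n. intros k Hk.
      specialize (Hn k Hk). specialize (Hbound k).
      destruct (Psi (zeta k)); simpl in *; [lra | contradiction].
    (* Any finite level rules out the value [PInf]. *)
    - assert (F : ele (Psi p) (Fin (f u + a + b + 1))); [|rewrite EP in F; exact F].
      apply (Hp _ (closed_convex_sublevel Psi _ PC PL)).
      destruct (Un_cv_eventually_le _ _ 1 He Rlt_0_1) as [n Hn]. exists n. intros k Hk.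
      specialize (Hn k Hk). specialize (Hbound k).
      destruct (Psi (zeta k)); simpl in *; [lra | contradiction]. }
  pose proof (tail_point_primal_dual p Hp) as Eq.
  clear - HPsi Eq. destruct p as [xp [vp qp]]. unfold Psi, c in HPsi. simpl in *. subst qp.
  destruct (g xp) as [a'|]; simpl in HPsi; [|contradiction].
  destruct (h (B xp)) as [b'|]; simpl in HPsi; [|contradiction].
  exists a', b'. repeat split. rewrite !hinner_0_r in HPsi. lra.
Qed.

Lemma tail_point_saddle p : tail_point zeta p -> saddle (fst p) (fst (snd p)).
Proof.
  intros Hp. pose proof (fun u w a b => tail_point_vi p u w a b Hp) as VI.
  destruct p as [xp [vp qp]]. simpl in *.
  destruct Hsaddle as (xs & vs & (as_ & Eas & _) & (bs & Ebs & _)).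
  (* The given saddle point serves only as a point with finite values, which makes the values at the
     tail point finite. *)
  destruct (VI xs (B xs) as_ bs Eas Ebs) as (a' & b' & Ea & Eb & _).
  split.
  - apply (subdiff_sum_gradient f gradf Hgrad g _ _ a' Hgc Ea). intros z.
    destruct (g z) as [a|] eqn:Ez; simpl; [|trivial].
    destruct (VI z (B xp) a b' Ez Eb) as (a2 & b2 & Ea2 & Eb2 & Hle).
    rewrite Ea in Ea2. rewrite Eb in Eb2. injection Ea2 as <-. injection Eb2 as <-.
    revert Hle. Bexpand. lra.
  - exists b'. split; [exact Eb|]. intros w. destruct (h w) as [b|] eqn:Ew; simpl; [|trivial].
    destruct (VI xp w a' b Ea Ew) as (a2 & b2 & Ea2 & Eb2 & Hle).
    rewrite Ea in Ea2. rewrite Eb in Eb2. injection Ea2 as <-. injection Eb2 as <-. lra.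
Qed.

(** Opial: the difference of the [cv_form] distances to the two saddle points converges and is
    affine in the iterate, so its linear part [c] takes the same value at both tail points. These
    values differ by [cv_form dx dv], which is therefore 0. *)
Lemma tail_point_unique p p' : tail_point zeta p -> tail_point zeta p' -> p = p'.
Proof.
  intros Hp Hp'.
  destruct (fejer_cv _ _ (tail_point_saddle p Hp)) as [l Hl].
  destruct (fejer_cv _ _ (tail_point_saddle p' Hp')) as [l' Hl'].
  pose proof (tail_point_primal_dual p Hp) as Q. pose proof (tail_point_primal_dual p' Hp') as Q'.
  destruct p as [x1 [v1 q1]], p' as [x2 [v2 q2]]. simpl in Q, Q', Hl, Hl'.
  set (dx := hsub x1 x2). set (dv := hsub v1 v2).
  set (c := (hsub (hscal al dx) (Bs dv), (hsub (hscal be dv) (B dx), hzero)) : Z).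
  pose proof (CV_minus _ _ _ _ Hl' Hl) as Hd. apply Un_cv_shift in Hd. cbv beta in Hd.
  pose proof (CV_plus _ _ _ _ Hd (Un_cv_const (cv_form x1 v1 - cv_form x2 v2))) as Hd2.
  apply (Un_cv_scal (/ 2)) in Hd2.
  assert (Hc : Un_cv (fun k => hinner (zeta k) c)
     (/ 2 * (l' - l + (cv_form x1 v1 - cv_form x2 v2)))).
  { revert Hd2. apply Un_cv_ext. intros k. unfold c, dx, dv, cv_form. simpl. rewrite hinner_0_r.
    Bexpand. lra. }
  pose proof (tail_point_inner _ _ _ _ Hp Hc) as E1.
  pose proof (tail_point_inner _ _ _ _ Hp' Hc) as E2.
  rewrite <- E2 in E1. simpl in E1. rewrite !hinner_0_r in E1.
  assert (E : cv_form dx dv = 0).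
  { unfold cv_form. unfold dx, dv in *. revert E1. Bexpand. lra. }
  destruct cv_form_coercive as (d & Hd0 & Hco). specialize (Hco dx dv). rewrite E in Hco.
  pose proof (hinner_pos X dx). pose proof (hinner_pos G dv).
  assert (0 <= L / 2 * hinner dx dx) by (apply Rmult_le_pos; lra).
  assert (Z1 : dx = hzero) by (apply hinner_def; nra).
  assert (Z2 : dv = hzero) by (apply hinner_def; nra).
  assert (Ex : x1 = x2).
  { apply hinner_ext. intros z. pose proof (f_equal (fun t => hinner t z) Z1) as F.
    unfold dx in F. cbv beta in F. rewrite hinner_sub_l, hinner_0_l in F. lra. }
  assert (Ev : v1 = v2).
  { apply hinner_ext. intros z. pose proof (f_equal (fun t => hinner t z) Z2) as F.
    unfold dv in F. cbv beta in F. rewrite hinner_sub_l, hinner_0_l in F. lra. }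
  subst. reflexivity.
Qed.

Theorem condat_vu_weak_cv : exists xbar,
  (forall z, ele (eadd (Fin (f xbar)) (eadd (g xbar) (h (B xbar))))
                 (eadd (Fin (f z)) (eadd (g z) (h (B z))))) /\
  weak_cv x xbar.
Proof.
  destruct zeta_bounded as [M HM].
  destruct (unique_tail_point_weak_cv zeta M HM tail_point_unique) as (p & Hp & Hw).
  pose proof (fun u w a b => tail_point_vi p u w a b Hp) as VI.
  destruct p as [xp [vp qp]]. simpl in VI. exists xp. split.
  - intros z. destruct (g z) as [a|] eqn:Ea; simpl; [|apply ele_PInf].
    destruct (h (B z)) as [b|] eqn:Eb; simpl; [|apply ele_PInf].
    (* With [w = B z] the dual term vanishes. *)
    destruct (VI z (B z) a b Ea Eb) as (a' & b' & -> & -> & Hle). simpl.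
    revert Hle. hexpand. lra.
  - intros z. apply Un_cv_unshift.
    specialize (Hw (z, (hzero, hzero))). simpl in Hw. rewrite !hinner_0_r, !Rplus_0_r in Hw.
    revert Hw. apply Un_cv_ext. intros k. rewrite !hinner_0_r. ring.
Qed.
End CondatVu.

(** * Finite products, starting from the empty one *)

Definition hunit : Hilbert.
Proof.
  refine {| hT := unit; hzero := tt; hadd := fun _ _ => tt; hopp := fun _ => tt;
    hscal := fun _ _ => tt; hinner := fun _ _ => 0 |}; intros; try lra; try reflexivity.
  - now destruct x.
  - now destruct x.
  - now destruct x.
  - exists tt. intros e He. exists 0%nat. intros. now rewrite sqrt_0.
Defined.

Section FiniteProduct.
Context (G : nat -> Hilbert).

(** Nested to the left, like the recursions of [hsum], [rsum] and [esum]. *)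
Fixpoint hpi (m : nat) : Hilbert :=
  match m with O => hunit | S n => hprod (hpi n) (G n) end.

Fixpoint tup (m : nat) (y : forall i, G i) : hpi m :=
  match m with O => tt | S n => (tup n y, y n) end.

Fixpoint hpi_sum (h : forall i, G i -> ereal) (m : nat) : hpi m -> ereal :=
  match m with
  | O => fun _ => Fin 0
  | S n => fun p => eadd (hpi_sum h n (fst p)) (h n (snd p))
  end.

Fixpoint hpi_adj {H : Hilbert} (Bs : forall i, G i -> H) (m : nat) : hpi m -> H :=
  match m with
  | O => fun _ => hzero
  | S n => fun p => hadd (hpi_adj Bs n (fst p)) (Bs n (snd p))
  end.

Lemma tup_add m y z : tup m (fun i => hadd (y i) (z i)) = hadd (tup m y) (tup m z).
Proof. induction m as [|m IH]; simpl; [reflexivity | now rewrite IH]. Qed.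

Lemma tup_scal m c y : tup m (fun i => hscal c (y i)) = hscal c (tup m y).
Proof. induction m as [|m IH]; simpl; [reflexivity | now rewrite IH]. Qed.

Lemma tup_sub m y z : tup m (fun i => hsub (y i) (z i)) = hsub (tup m y) (tup m z).
Proof. unfold hsub. induction m as [|m IH]; simpl; [reflexivity | now rewrite IH]. Qed.

Lemma tup_ext m (y z : forall i, G i) : (forall i, (i < m)%nat -> y i = z i) -> tup m y = tup m z.
Proof.
  induction m as [|m IH]; intros E; simpl; [reflexivity|].
  rewrite IH by (intros; apply E; lia). now rewrite E by lia.
Qed.

Lemma hpi_sum_tup h m y : hpi_sum h m (tup m y) = esum m (fun i => h i (y i)).
Proof. induction m as [|m IH]; simpl; [reflexivity | now rewrite IH]. Qed.

Lemma hpi_adj_tup {H : Hilbert} (Bs : forall i, G i -> H) m y :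
  hpi_adj Bs m (tup m y) = hsum m (fun i => Bs i (y i)).
Proof. induction m as [|m IH]; simpl; [reflexivity | now rewrite IH]. Qed.

Lemma convex_hpi_sum h m : (forall i, (i < m)%nat -> convex (h i)) -> convex (hpi_sum h m).
Proof.
  induction m as [|m IH]; intros Hc.
  - intros x y t Ht. simpl. lra.
  - exact (convex_eadd _ _
      (convex_comp _ (bounded_linear_fst (hpi m) (G m)) _
        (IH (fun i Hi => Hc i (Nat.lt_lt_succ_r _ _ Hi))))
      (convex_comp _ (bounded_linear_snd (hpi m) (G m)) _ (Hc m (Nat.lt_succ_diag_r m)))).
Qed.

Lemma lsc_hpi_sum h m : (forall i, (i < m)%nat -> lsc (h i)) -> lsc (hpi_sum h m).
Proof.
  induction m as [|m IH]; intros Hc.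
  - intros r u l _ Hle. exact (Hle 0%nat).
  - exact (lsc_eadd _ _
      (lsc_comp _ (bounded_linear_fst (hpi m) (G m)) _
        (IH (fun i Hi => Hc i (Nat.lt_lt_succ_r _ _ Hi))))
      (lsc_comp _ (bounded_linear_snd (hpi m) (G m)) _ (Hc m (Nat.lt_succ_diag_r m)))).
Qed.

Lemma subdiff_hpi_sum h m q v :
  (forall i, (i < m)%nat -> subdiff (h i) (q i) (v i)) ->
  subdiff (hpi_sum h m) (tup m q) (tup m v).
Proof.
  induction m as [|m IH]; intros Hs.
  - exists 0. split; [reflexivity|]. intros z. simpl. lra.
  - destruct IH as (a & Ea & Ha); [intros; apply Hs; lia|].
    destruct (Hs m) as (b & Eb & Hb); [lia|].
    exists (a + b). split; [simpl; now rewrite Ea, Eb|].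
    intros [z1 z2]. specialize (Ha z1). specialize (Hb z2). unfold hsub in *. simpl in *.
    destruct (hpi_sum h m z1), (h m z2); simpl in *; trivial. lra.
Qed.

Context {H : Hilbert} (B : forall i, H -> G i).

Lemma adjoint_tup Bs m : (forall i, (i < m)%nat -> is_adjoint (B i) (Bs i)) ->
  is_adjoint (fun x => tup m (fun i => B i x)) (hpi_adj Bs m).
Proof.
  induction m as [|m IH]; intros HA x p; simpl.
  - now rewrite hinner_0_r.
  - rewrite hinner_add_r, <- (HA m) by lia. f_equal. apply IH. intros; apply HA; lia.
Qed.

Lemma tup_sq_le (nB : nat -> R) m x :
  (forall i, (i < m)%nat -> hinner (B i x) (B i x) <= nB i ^ 2 * hinner x x) ->
  hinner (tup m (fun i => B i x)) (tup m (fun i => B i x))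
    <= rsum m (fun i => nB i ^ 2) * hinner x x.
Proof.
  induction m as [|m IH]; intros Hle; cbn [tup rsum].
  - simpl. lra.
  - change (hinner (tup m (fun i => B i x)) (tup m (fun i => B i x)) + hinner (B m x) (B m x)
      <= (rsum m (fun i => nB i ^ 2) + nB m ^ 2) * hinner x x).
    specialize (Hle m ltac:(lia)) as Hm.
    specialize (IH (fun i Hi => Hle i (Nat.lt_lt_succ_r _ _ Hi))). lra.
Qed.
End FiniteProduct.

(** * Operator norms and reduction of the theorem to the Condat-Vu iteration *)

Lemma opnorm_sq_le {H G : Hilbert} (B : H -> G) c x :
  bounded_linear B -> is_opnorm B c -> hinner (B x) (B x) <= c ^ 2 * hinner x x.
Proof.
  intros HB [Hub _]. pose proof (hnorm_pos x) as Hx.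
  (* A zero vector cannot be normalized; there boundedness alone makes the left side vanish. *)
  destruct (Req_dec (hnorm x) 0) as [E|E].
  - assert (E0 : hinner x x = 0) by (rewrite <- hnorm_sq, E; ring).
    destruct (bounded_linear_sq_bound B HB) as (d & _ & Hd). specialize (Hd x).
    rewrite E0 in *. lra.
  - assert (Hle : hnorm (B (hscal (/ hnorm x) x)) <= c).
    { apply Hub. exists (hscal (/ hnorm x) x). split; [|reflexivity].
      rewrite hnorm_scal, Rabs_inv, Rabs_pos_eq, Rinv_l; lra. }
    destruct HB as (_ & Hs & _). rewrite Hs, hnorm_scal, Rabs_inv, Rabs_pos_eq in Hle by lra.
    apply (Rmult_le_compat_l (hnorm x)) in Hle; [|lra].
    rewrite <- Rmult_assoc, Rinv_r, Rmult_1_l in Hle by lra.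
    pose proof (hnorm_pos (B x)). rewrite <- !hnorm_sq. nra.
Qed.

Lemma rsum_nonneg m F : (forall i, 0 <= F i) -> 0 <= rsum m F.
Proof. intros HF. induction m as [|m IH]; simpl; [lra | specialize (HF m); lra]. Qed.

Lemma hsum_scal {H : Hilbert} m c (F F' : nat -> H) :
  (forall i, (i < m)%nat -> F' i = hscal c (F i)) -> hsum m F' = hscal c (hsum m F).
Proof.
  induction m as [|m IH]; intros E; simpl.
  - hvec.
  - rewrite IH, E by (auto with arith). hvec.
Qed.

Lemma adjoint_scal {H G : Hilbert} (B : H -> G) Bs c y :
  is_adjoint B Bs -> Bs (hscal c y) = hscal c (Bs y).
Proof.
  intros HA. apply hinner_ext. intros z.
  rewrite hinner_scal, !(hinner_sym H _ z), <- !HA. apply hinner_scal_r.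
Qed.

Theorem theorem4p8
  (H : Hilbert) (m : nat) (G : nat -> Hilbert)
  (f : H -> R) (gradf : H -> H) (L : R) (g : H -> ereal)
  (h : forall i, G i -> ereal) (B : forall i, H -> G i) (Bs : forall i, G i -> H)
  (nB : nat -> R)
  (HL : 0 < L)
  (Hfconv : convex_real f)
  (Hgrad : is_gradient f gradf)
  (Hlip : forall u v, hnorm (hsub (gradf u) (gradf v)) <= L * hnorm (hsub u v))
  (Hg : Gamma0 g)
  (Hh : forall i, (i < m)%nat -> Gamma0 (h i))
  (HB : forall i, (i < m)%nat -> bounded_linear (B i))
  (HBs : forall i, (i < m)%nat -> is_adjoint (B i) (Bs i))
  (HnB : forall i, (i < m)%nat -> is_opnorm (B i) (nB i))
  (Hexist : exists (xhat : H) (u : H) (v : forall i, G i),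
      subdiff g xhat u /\
      (forall i, (i < m)%nat -> subdiff (h i) (B i xhat) (v i)) /\
      hadd (gradf xhat) (hadd u (hsum m (fun i => Bs i (v i)))) = hzero)
  (gamma sigma tau : R)
  (Hgam : 0 < gamma < 2 / L) (Hsig : 0 < sigma) (Htau : 0 < tau)
  (Hst : sigma * tau * rsum m (fun i => nB i ^ 2) < 1)
  (x : nat -> H) (y : nat -> forall i, G i)
  (Hx : forall k, x (S k) =
      prox (tau * gamma / (1 + tau)) g
        (hscal (/ (1 + tau))
           (hadd (hsub (x k) (hscal tau (hsum m (fun i => Bs i (y k i)))))
                 (hscal tau (hsub (x k) (hscal gamma (gradf (x k))))))))
  (Hy : forall k i, (i < m)%nat -> y (S k) i =
      hscal gamma
        (prox (sigma / gamma) (fconj (h i))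
           (hscal (/ gamma)
              (hadd (y k i) (hscal sigma (B i (hsub (hscal 2 (x (S k))) (x k))))))))
  : exists xbar : H,
      (forall z : H,
         ele (eadd (Fin (f xbar)) (eadd (g xbar) (esum m (fun i => h i (B i xbar)))))
             (eadd (Fin (f z)) (eadd (g z) (esum m (fun i => h i (B i z)))))) /\
      weak_cv x xbar.
Proof.
  destruct Hexist as (xhat & uhat & vhat & Sg & Sh & Ehat).
  destruct Hg as (Hgp & Hgc & Hgl).
  set (N := rsum m (fun i => nB i ^ 2)) in *.
  set (al := (1 + tau) / (tau * gamma)). set (be := gamma / sigma).
  assert (HN0 : 0 <= N) by (apply rsum_nonneg; intros; nra).
  assert (Hgamma : L / 2 < / gamma).
  { apply (Rmult_lt_reg_r gamma); [lra|]. rewrite Rinv_l by lra.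
    destruct Hgam as [_ Hgam]. apply (Rmult_lt_compat_r L) in Hgam; [|lra].
    unfold Rdiv in Hgam. rewrite Rmult_assoc, Rinv_l in Hgam by lra. lra. }
  (* The summand [1 / gamma] absorbs [L / 2]; the other one times [be] is [1 / (sigma * tau)], which
     exceeds [N]. *)
  assert (Eal : al = / (tau * gamma) + / gamma) by (unfold al; field; lra).
  assert (Htg : 0 < / (tau * gamma)) by (apply Rinv_0_lt_compat; nra).
  assert (Hbe : 0 < be) by (unfold be; apply Rdiv_lt_0_compat; lra).
  assert (Hstep : N < (al - L / 2) * be).
  { apply Rlt_trans with (/ (tau * gamma) * be); [|apply Rmult_lt_compat_r; lra].
    replace (/ (tau * gamma) * be) with (/ (sigma * tau)) by (unfold be; field; lra).
    apply (Rmult_lt_reg_l (sigma * tau)); [nra|]. rewrite Rinv_r by nra. exact Hst. }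
  set (BT := fun z : H => tup G m (fun i => B i z)).
  set (v := fun k i => hscal (/ gamma) (y k i)).
  assert (HBN : forall z, hinner (BT z) (BT z) <= N * hinner z z).
  { intros z. apply tup_sq_le. intros i Hi. apply opnorm_sq_le; auto. }
  destruct (condat_vu_weak_cv H (hpi G m) f gradf g (hpi_sum G h m) BT (hpi_adj G Bs m)
    L N al be) with (x := x) (v := fun k => tup G m (v k)) as (xbar & Hopt & Hw); auto.
  - apply convex_hpi_sum. intros i Hi. now apply Hh.
  - apply lsc_hpi_sum. intros i Hi. now apply Hh.
  - apply bounded_linear_sq with (c := N); [| |exact HBN]; intros; unfold BT.
    + rewrite <- tup_add. apply tup_ext. intros i Hi. now apply HB.
    + rewrite <- tup_scal. apply tup_ext. intros i Hi. now apply HB.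
  - now apply adjoint_tup.
  - lra.
  - intros k. rewrite hpi_adj_tup.
    rewrite (hsum_scal m (/ gamma) (fun i => Bs i (y k i)))
      by (intros i Hi; unfold v; now apply (adjoint_scal (B i)), HBs).
    (* [lam] is [1 / al], so dividing the residual by [lam] turns the prox argument into
       [al x - Bs v - gradf x]. *)
    set (lam := tau * gamma / (1 + tau)) in *.
    assert (Hlam : 0 < lam) by (apply Rdiv_lt_0_compat; nra).
    pose proof (prox_subdiff g Hgp Hgc Hgl lam
       (hscal (/ (1 + tau))
           (hadd (hsub (x k) (hscal tau (hsum m (fun i => Bs i (y k i)))))
                 (hscal tau (hsub (x k) (hscal gamma (gradf (x k)))))))
       Hlam (subdiff_affine_minorant _ _ _ Sg)) as P.
    rewrite <- Hx in P. revert P. match goal with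
    | |- subdiff _ _ ?a -> subdiff _ _ ?b => replace a with b; [trivial|]
    end. unfold al, lam. hvec; lra.
  - intros k. cbv beta. unfold BT. rewrite <- tup_sub, <- tup_scal, <- tup_add.
    apply subdiff_hpi_sum. intros i Hi.
    (* The parameter [sigma / gamma] is [1 / be]: the scaled residual is the [i]-th component of
       [q k]. *)
    pose proof (prox_fconj_subdiff (h i) (sigma / gamma)
      (hscal (/ gamma) (hadd (y k i) (hscal sigma (B i (hsub (hscal 2 (x (S k))) (x k))))))
      (Hh i Hi) (subdiff_affine_minorant _ _ _ (Sh i Hi))) as P.
    specialize (P ltac:(apply Rdiv_lt_0_compat; lra)).
    specialize (Hy k i Hi). revert P Hy. generalize (B i (hsub (hscal 2 (x (S k))) (x k))).
    intros w. match goal with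
    | |- context [prox ?l ?phi ?u] => generalize (prox l phi u)
    end. intros p P Hy.
    assert (Ep : v (S k) i = p) by (unfold v; rewrite Hy; hvec; lra).
    rewrite Ep. revert P. match goal with
    | |- subdiff _ ?a _ -> subdiff _ ?b _ => replace a with b; [trivial|]
    end. unfold be, v. hvec; lra.
  (* The assumed inclusion at [xhat] says that this pair is a saddle point. *)
  - exists xhat, (tup G m vhat). split.
    + rewrite hpi_adj_tup.
      replace (hsub (hopp (hsum m (fun i => Bs i (vhat i)))) (gradf xhat)) with uhat; [exact Sg|].
      apply hinner_ext. intros z. pose proof (f_equal (fun t => hinner t z) Ehat) as E.
      revert E. cbv beta. autorewrite with hinner. lra.
    + now apply subdiff_hpi_sum.
  - exists xbar. split; [|exact Hw]. intros z. specialize (Hopt z). unfold BT in Hopt.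
    now rewrite !hpi_sum_tup in Hopt.
Qed.
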